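(* Let $\Lambda(z)=z^{m+n}+\sum_{k=1}^{m+n}d_k z^{m+n-k}\in\mathbb{C}[z]$ and assume that all the coefficients $d_k$, $1\le k\le m+n$, are non-zero. Let $f_1,\ldots,f_{m+n}\in L_c[x_1^{\pm},\ldots,x_m^{\pm},y_1^{\pm},\ldots,y_n^{\pm}]$ be the polynomials defined by $$f_k=e_k(x_1,\ldots,x_m,y_1,\ldots,y_n)+t\,p_{k-1}(x_1,\ldots,x_m,y_1,\ldots,y_n)-d_k,$$ and let $\mathrm{Def}_{qq}=V(\{f_1,\ldots,f_{m+n}\})\subset(L_c^{\times})^{m+n}$. Then the set of polynomials $f_1,\ldots,f_{m+n}$ forms a tropical basis of the tropical variety $\mathrm{trop}(\mathrm{Def}_{qq})$, i.e. $$\mathrm{trop}(\mathrm{Def}_{qq})=\bigcap_{k=1}^{m+n}\mathrm{trop}(V(f_k)),$$ and $\mathrm{trop}(\mathrm{Def}_{qq})=\{(0,\ldots,0)\}$.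
   Context: $L_c$ is the field of convergent Puiseux series in $t$ with complex coefficients: series $\sum_{k\ge k_0}c_kt^{k/N}$ ($N\in\mathbb{Z}_{>0}$, $k_0\in\mathbb{Z}$) that converge in a neighborhood of $0$ (punctured at $0$ if the valuation is negative), with valuation $\nu$ equal to the lowest exponent with nonzero coefficient. It is algebraically closed with residue field $\mathbb{C}$. Here $e_k$ is the $k$-th elementary symmetric polynomial in the $m+n$ variables, and $p_{k-1}$ is the polynomial with integer coefficients given by the coefficient of $z^{m+n-k}$ in the Wronskian $q_+\partial_zq_- - q_-\partial_zq_+$ of $q_+(z)=\prod_{i=1}^m(z+x_i)$ and $q_-(z)=\prod_{j=1}^n(z+y_j)$. Thus $f_1=\cdots=f_{m+n}=0$ is equivalent to $q_+q_-+tW(q_+,q_-)=\Lambda$. For a Laurent polynomial $f=\sum_{u}c_u x^u$ over $L_c$ in $M$ variables, $\mathrm{trop}(f)(w)=\min_u(\nu(c_u)+u\cdot w)$ for $w\in\mathbb{R}^M$, and $\mathrm{trop}(V(f))$ is the set of $w\in\mathbb{R}^M$ at which this minimum is achieved at least twice. For an ideal $I$ with variety $X=V(I)$ in the torus $(L_c^\times)^M$, $\mathrm{trop}(X)=\bigcap_{f\in I}\mathrm{trop}(V(f))$. A finite generating set $\mathcal{T}$ of $I$ is a tropical basis if $\mathrm{trop}(V(I))=\bigcap_{f\in\mathcal{T}}\mathrm{trop}(V(f))$; here $I$ is the ideal generated by $f_1,\ldots,f_{m+n}$. *)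

(* Defs.v *)
From HB Require Import structures.
From mathcomp Require Import all_boot all_order all_algebra finmap complex.
From mathcomp Require Import mathcomp_extra boolp classical_sets functions.
From mathcomp Require Import cardinality fsbigop reals ereal topology.
From mathcomp Require Import normedtype sequences.

Set Implicit Arguments.
Unset Strict Implicit.
Unset Printing Implicit Defensive.

Import Order.TTheory GRing.Theory Num.Theory.
Import numFieldNormedType.Exports.

Local Open Scope classical_set_scope.
Local Open Scope ring_scope.
Local Open Scope complex_scope.

Local Notation Re := complex.Re.
Local Notation Im := complex.Im.

Section Series.
Variable R : realType.
Local Notation C := (R[i]).

Implicit Types (a b : rat -> C) (al be ga : nat -> C) (N M n : nat) (k l : int).

Definition pexpo N k (j : nat) : rat := (k + j%:Z)%:~R / N%:R.

(* The formal series \sum_q (a q) t^q is \sum_(k >= k0) c_k t^(k/N) for some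
   N > 0 and k0, and \sum_(k >= k0) c_k s^k (where s = t^(1/N)) converges on
   a punctured disc.                                                         *)
Definition is_cpuiseux a := exists N k0,
  [/\ (0 < N)%N,
      forall q, a q != 0 -> exists j, q = pexpo N k0 j
    & exists2 r : R, 0 < r & forall s : C, 0 < `|s| < r%:C ->
        cvgn (series (fun j => (a (pexpo N k0 j) * s ^ (k0 + j%:Z) : C^o)))].

(* The sum has finite support when a and b are Puiseux series. *)
Definition conv a b : rat -> C :=
  fun q => \sum_(p \in [set: rat]) a p * b (q - p).

(* c t^r *)
Definition single (c : C) (r : rat) : rat -> C :=
  fun q => if q == r then c else 0.

(* Equivalent, by geoP, to a positive radius of convergence; only used to
   prove the closure properties.                                          *)
Let geo al := exists2 A : C, 1 <= A & forall j, `|al j| <= A ^+ j.+1.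

Lemma geoW al (A : C) : 0 <= A -> (forall j, `|al j| <= A ^+ j.+1) -> geo al.
Proof.
move=> A0 alA; exists (1 + A) => [|j]; first by rewrite lerDl.
by apply: le_trans (alA j) _; rewrite lerXn2r ?nnegrE ?addr_ge0 // lerDr.
Qed.

Lemma cvg_complex (u : nat -> C) :
  cvgn (series (fun j => Re (u j))) -> cvgn (series (fun j => Im (u j))) ->
  cvgn (series (u : nat -> C^o)).
Proof.
move=> /cvg_ex[x ux] /cvg_ex[y uy].
apply/cvg_ex; exists (x +i* y).
apply/cvgrPdist_lt => e e0.
have eE : e = (Re e)%:C by rewrite RRe_real ?gtr0_real.
have e20 : 0 < Re e / 2 by rewrite divr_gt0 // -ltcR -eE.
move/cvgrPdist_lt: ux => /(_ _ e20) ux.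
move/cvgrPdist_lt: uy => /(_ _ e20) uy.
near=> n.
have hx : `|x - series (fun j => Re (u j)) n| < Re e / 2 by near: n.
have hy : `|y - series (fun j => Im (u j)) n| < Re e / 2 by near: n.
have -> : (x +i* y : C) - series (u : nat -> C^o) n =
  (x - series (fun j => Re (u j)) n)%:C +
  'i * (y - series (fun j => Im (u j)) n)%:C.
  rewrite [LHS]complexE !raddfB /= /series /=.
  rewrite (raddf_sum (@Re R : Rcomplex R -> R)).
  by rewrite (raddf_sum (@Im R : Rcomplex R -> R)).
apply: le_lt_trans (ler_normD _ _) _; rewrite normrM.
have -> : `|'i%C| = 1 :> C.
  by rewrite normc_def /= expr0n expr1n add0r sqrtr1.
have nC (z : R) : `|z%:C| = `|z|%:C.
  by rewrite normc_def /= expr0n addr0 sqrtr_sqr.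
by rewrite mul1r !nC eE [Re e]splitr rmorphD /= ltrD // ltcR.
Unshelve. all: end_near. Qed.

Lemma geoP al k : geo al <->
  exists2 r : R, 0 < r & forall s : C, 0 < `|s| < r%:C ->
    cvgn (series (fun j => (al j * s ^ (k + j%:Z) : C^o))).
Proof.
split=> [[A A1 alA]|[r r0 H]].
  have A0 : 0 < A by rewrite (lt_le_trans ltr01).
  have AE : A = (Re A)%:C by rewrite RRe_real ?gtr0_real.
  have ReA0 : 0 < Re A by rewrite -ltcR -AE.
  exists (Re A * 2)^-1; first by rewrite invr_gt0 mulr_gt0.
  move=> s /andP[s0 sr].
  have sN0 : s != 0 by rewrite -normr_gt0.
  pose D := A * `|s ^ k|.
  have D0 : 0 <= D by rewrite mulr_ge0 // ltW.
  have DE : D = (Re D)%:C by rewrite RRe_real ?ger0_real.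
  have uD j : `|al j * s ^ (k + j%:Z)| <= (Re D * 2^-1 ^+ j)%:C.
    rewrite normrM expfzDr // normrM mulrA rmorphM /= -DE.
    apply: le_trans (_ : (A ^+ j.+1 * `|s ^ k|) * `|s| ^+ j <= _).
      by rewrite -exprnP normrX !ler_wpM2r // exprn_ge0.
    rewrite exprS -mulrA mulrACA -exprMn rmorphXn /=.
    apply: ler_wpM2l => //; rewrite lerXn2r ?nnegrE //.
    - by rewrite mulr_ge0 // ltW.
    - by rewrite ler0c invr_ge0.
    rewrite {1}AE; apply: le_trans (_ : (Re A)%:C * (Re A * 2)^-1%:C <= _).
      by rewrite ler_wpM2l ?ler0c 1?ltW.
    by rewrite -rmorphM /= lecR invfM mulrA divff ?mul1r // gt_eqF.
  have ReD0 : 0 <= Re D by rewrite -ler0c -DE.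
  have gcv : cvgn (series (geometric (Re D) (2^-1 : R))).
    by apply: is_cvg_geometric_series; rewrite ger0_norm ?invr_ge0 // invf_lt1 ?ltr1n.
  have dom (v : nat -> R) : (forall j, `|v j| <= Re D * 2^-1 ^+ j) ->
      cvgn (series v).
    move=> vD; apply: normed_cvg; apply: series_le_cvg gcv => n //=.
    by rewrite mulr_ge0 // exprn_ge0 // invr_ge0.
  apply: cvg_complex; apply: dom => j; rewrite -lecR; apply: le_trans (uD j).
    exact: normc_ge_Re.
  by rewrite normc_def lecR -sqrtr_sqr ler_wsqrtr // lerDr sqr_ge0.
pose s : C := (r / 2)%:C.
have s0 : 0 < s by rewrite ltcR divr_gt0.
have sN0 : s != 0 by rewrite gt_eqF.
have : 0 < `|s| < r%:C.
  by rewrite gtr0_norm // s0 ltcR ltr_pdivrMr // ltr_pMr // ltr1n.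
move=> /H /cvg_series_cvg_0 /cvgr0_norm_le /(_ _ ltr01) [n0 _ Hn0].
pose u j : C := al j * s ^ (k + j%:Z).
pose D := 1 + \sum_(i < n0) `|u i|.
have D1 : 1 <= D by rewrite lerDl sumr_ge0.
have uD j : `|u j| <= D.
  have [/Hn0 h|h] := leqP n0 j; first exact: le_trans h D1.
  rewrite /D (bigD1 (Ordinal h)) //= addrCA lerDl addr_ge0 //.
  by rewrite sumr_ge0.
have sk0 : 0 <= s ^ (- k) by rewrite exprz_ge0 // ltW.
have sV0 : 0 <= s^-1 by rewrite invr_ge0 ltW.
have Dk0 : 0 <= D * s ^ (- k) by rewrite mulr_ge0 // (le_trans ler01).
apply: (@geoW _ (D * s ^ (- k) + s^-1)) => [|j]; first exact: addr_ge0.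
have -> : al j = u j * s ^ (- k) * s^-1 ^+ j.
  rewrite /u -invr_expz exprVn expfzDr // -exprnP -!mulrA.
  by rewrite [s ^+ j * _]mulrCA mulfV ?expf_neq0 // mulr1 mulfV ?mulr1 // expfz_neq0.
rewrite exprS 2!normrM normrX.
rewrite (ger0_norm sk0) (ger0_norm sV0).
apply: ler_pM; [exact: mulr_ge0 | exact: exprn_ge0 | |].
  apply: le_trans (_ : D * s ^ (- k) <= _); first by rewrite ler_wpM2r.
  by rewrite lerDl.
by apply: lerXn2r; rewrite ?nnegrE ?lerDr //; apply: addr_ge0.
Qed.

(* \sum_j al_j t^((k + j) / N) *)
Let emb N k al : rat -> C := fun q =>
  let j := `|numq (q * N%:R - k%:~R)|%N in
  if q == pexpo N k j then al j else 0.

Lemma pexpo_idx N k j : (0 < N)%N ->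
  `|numq (pexpo N k j * N%:R - k%:~R)|%N = j.
Proof.
move=> N0; rewrite /pexpo divfK ?pnatr_eq0 -?lt0n //.
by rewrite rmorphD /= addrC addKr numq_int.
Qed.

Lemma pexpo_inj N k : (0 < N)%N -> injective (pexpo N k).
Proof. by move=> N0 i j ij; rewrite -(pexpo_idx k i N0) ij pexpo_idx. Qed.

Lemma embE N k al j : (0 < N)%N -> emb N k al (pexpo N k j) = al j.
Proof. by move=> N0; rewrite /emb pexpo_idx // eqxx. Qed.

Lemma emb_neq0 N k al q : emb N k al q != 0 -> exists j, q = pexpo N k j.
Proof.
rewrite /emb; case: ifP => [/eqP qE _|_]; last by rewrite eqxx.
by eexists; exact: qE.
Qed.

Lemma emb_out N k al q : (forall j, q <> pexpo N k j) -> emb N k al q = 0.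
Proof. by move=> H; apply/eqP/negPn/negP => /emb_neq0[j /H]. Qed.

Lemma eq_emb N k al a : (0 < N)%N ->
  (forall q, a q != 0 -> exists j, q = pexpo N k j) ->
  (forall j, a (pexpo N k j) = al j) -> a = emb N k al.
Proof.
move=> N0 H Ha; apply/funext => q.
have [[j ->]|nq] := pselect (exists j, q = pexpo N k j).
  by rewrite Ha embE.
rewrite emb_out => [|j qj]; last by apply: nq; exists j.
by apply/eqP/negPn/negP => /H.
Qed.

Lemma puiseuxP a : is_cpuiseux a <->
  exists N k al, [/\ (0 < N)%N, geo al & a = emb N k al].
Proof.
split=> [[N [k [N0 Ha cv]]]|[N [k [al [N0 gal ->]]]]].
  exists N, k, (fun j => a (pexpo N k j)); split=> //; last exact: eq_emb.
  exact/(geoP _ k).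
exists N, k; split=> // [q /emb_neq0 //|].
have [r r0 H] := (geoP al k).1 gal; exists r; first exact: r0.
move=> s sr; have h := H s sr.
have E : al = emb N k al \o pexpo N k.
  by apply/funext => j; rewrite /= embE.
by rewrite E in h; exact: h.
Qed.

Lemma emb_scale N M k al : (0 < N)%N -> (0 < M)%N -> geo al ->
  exists2 be, geo be & emb N k al = emb (N * M) (k * M%:Z) be.
Proof.
move=> N0 M0 [A A1 alA].
exists (fun i => if (M %| i)%N then al (i %/ M)%N else 0).
  exists A => // j; case: ifP => _; last first.
    by rewrite normr0 exprn_ge0 // (le_trans ler01).
  apply: le_trans (alA _) _; apply: ler_weXn2l => //.
  by rewrite ltnS leq_div.
have NM0 : (0 < N * M)%N by rewrite muln_gt0 N0.
have pE j : pexpo N k j = pexpo (N * M) (k * M%:Z) (j * M).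
  rewrite /pexpo PoszM -mulrDl rmorphM /= natrM -mulf_div.
  by rewrite -pmulrn divff ?mulr1 // pnatr_eq0 -lt0n.
apply: eq_emb => // [q /emb_neq0[j ->]|j]; first by exists (j * M)%N.
case: ifP => [Mj|/negP Mj].
  by rewrite -{1}(divnK Mj) -pE embE.
apply: emb_out => i; rewrite pE => /(pexpo_inj NM0) jE.
by apply: Mj; rewrite jE dvdn_mull.
Qed.

Lemma emb_shift N k n al : (0 < N)%N ->
  emb N k al = emb N (k - n%:Z) (fun i => if (i < n)%N then 0 else al (i - n)%N).
Proof.
move=> N0.
have pE j : pexpo N k j = pexpo N (k - n%:Z) (j + n).
  by rewrite /pexpo PoszD addrACA addNr addr0.
apply: eq_emb => // [q /emb_neq0[j ->]|j]; first by exists (j + n)%N.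
case: ltnP => [jn|nj].
  apply: emb_out => i; rewrite pE => /(pexpo_inj N0) jE.
  by move: jn; rewrite jE ltnNge leq_addl.
by rewrite -{1}(subnK nj) -pE embE.
Qed.

Lemma geo_shift n al : geo al -> geo (fun i => if (i < n)%N then 0 else al (i - n)%N).
Proof.
case=> A A1 alA; exists A => // j; case: ifP => _.
  by rewrite normr0 exprn_ge0 // (le_trans ler01).
by apply: le_trans (alA _) _; rewrite ler_weXn2l // ltnS leq_subr.
Qed.

Lemma puiseux2 a b : is_cpuiseux a -> is_cpuiseux b ->
  exists N k al be, [/\ (0 < N)%N, geo al /\ geo be,
    a = emb N k al & b = emb N k be].
Proof.
move=> /puiseuxP[N [k [al [N0 gal ->]]]] /puiseuxP[M [l [be [M0 gbe ->]]]].
have [al' gal' ->] := emb_scale k N0 M0 gal.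
have [be' gbe' ->] := emb_scale l M0 N0 gbe.
rewrite mulnC; have NM0 : (0 < M * N)%N by rewrite muln_gt0 N0 M0.
have [n [m knm]] : exists n m : nat, k * M%:Z - n%:Z = l * N%:Z - m%:Z.
  have [d dE] : exists d, k * M%:Z - l * N%:Z = d by eexists.
  case: d dE => d dE.
    by exists d, 0%N; rewrite -dE subr0 opprB addrC subrK.
  exists 0%N, d.+1; rewrite subr0 -NegzE -dE.
  by rewrite addrC subrK.
rewrite (emb_shift (k * M%:Z) n al' NM0) (emb_shift (l * N%:Z) m be' NM0) knm.
exists (M * N)%N, (l * N%:Z - m%:Z); do 2!eexists; split; [exact: NM0 | | by [] | by []].
by split; exact: geo_shift.
Qed.

Let cauchy al be : nat -> C := fun n => \sum_(i < n.+1) al i * be (n - i)%N.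

Let pol n al : {poly C} := \poly_(i < n) al i.

Lemma cauchyE n m al be : (m < n)%N ->
  cauchy al be m = (pol n al * pol n be)`_m.
Proof.
move=> mn; rewrite coefM; apply: eq_bigr => i _; rewrite !coef_poly.
have im : (i <= m)%N by rewrite -ltnS.
by rewrite (leq_ltn_trans im mn) (leq_ltn_trans (leq_subr _ _) mn).
Qed.

Lemma cauchyC al be : cauchy al be = cauchy be al.
Proof. by apply/funext => n; rewrite !(@cauchyE n.+1) // mulrC. Qed.

Lemma cauchyA al be ga : cauchy al (cauchy be ga) = cauchy (cauchy al be) ga.
Proof.
have L x y z n : cauchy x (cauchy y z) n = (pol n.+1 x * (pol n.+1 y * pol n.+1 z))`_n.
  rewrite /cauchy coefM; apply: eq_bigr => i _; rewrite coef_poly ltn_ord.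
  by rewrite -cauchyE // ltnS leq_subr.
apply/funext => n; rewrite L [in RHS]cauchyC L.
by rewrite mulrA mulrC.
Qed.

Let delta : nat -> C := fun n => (n == 0)%:R.

Lemma cauchy1 al : cauchy delta al = al.
Proof.
apply/funext => n; rewrite /cauchy big_ord_recl /= mul1r subn0.
by rewrite big1 ?addr0 // => i _; rewrite mul0r.
Qed.

Lemma geo_cauchy al be : geo al -> geo be -> geo (cauchy al be).
Proof.
case=> A A1 alA [B B1 beB].
pose M := A + B.
have A0 : 0 <= A by rewrite (le_trans ler01).
have B0 : 0 <= B by rewrite (le_trans ler01).
have M0 : 0 <= M by apply: addr_ge0.
have M1 : 1 <= M by rewrite (le_trans A1) // lerDl.
have X j : A ^+ j <= M ^+ j by rewrite lerXn2r ?nnegrE // lerDl.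
have Y j : B ^+ j <= M ^+ j by rewrite lerXn2r ?nnegrE // lerDr.
apply: (@geoW _ (2 * M ^+ 2)) => [|n]; first by rewrite mulr_ge0 ?exprn_ge0.
apply: le_trans (ler_norm_sum _ _ _) _.
apply: le_trans (_ : \sum_(i < n.+1) (M ^+ 2) ^+ n.+1 <= _).
  apply: ler_sum => i _; rewrite normrM.
  apply: le_trans (_ : M ^+ i.+1 * M ^+ (n - i).+1 <= _).
    by apply: ler_pM => //; [apply: le_trans (X _) | apply: le_trans (Y _)].
  rewrite -exprD -exprM ler_weXn2l //.
  have := ltn_ord i; rewrite ltnS => /subnKC.
  by rewrite addSn addnS => ->; rewrite mul2n -addnn addSn addnS !ltnS leq_addr.
rewrite sumr_const card_ord [leRHS]exprMn -[leLHS]mulr_natl.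
apply: ler_wpM2r; first by rewrite !exprn_ge0.
by rewrite -natrX ler_nat ltnW // ltn_expl.
Qed.

Lemma geoD al be : geo al -> geo be -> geo (fun n => al n + be n).
Proof.
case=> A A1 alA [B B1 beB].
have A0 : 0 <= A by rewrite (le_trans ler01).
have B0 : 0 <= B by rewrite (le_trans ler01).
apply: (@geoW _ (A + B)) => [|n]; first exact: addr_ge0.
apply: le_trans (ler_normD _ _) _.
apply: le_trans (lerD (alA n) (beB n)) _.
rewrite !exprS mulrDl lerD // ler_wpM2l // lerXn2r ?nnegrE ?addr_ge0 //.
  by rewrite lerDl.
by rewrite lerDr.
Qed.

Lemma geoN al : geo al -> geo (fun n => - al n).
Proof. by case=> A A1 alA; exists A => // n; rewrite normrN. Qed.

Lemma geo_delta c : geo (fun n => if n == 0%N then c else 0).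
Proof.
apply: (@geoW _ `|c|) => // -[|n] /=; first by rewrite expr1.
by rewrite normr0 exprn_ge0.
Qed.

Lemma cauchy_inv al : al 0%N != 0 -> geo al ->
  exists2 be, geo be & cauchy be al = delta.
Proof.
move=> al0 [A A1 alA].
pose L := fix L n : seq C := if n is m.+1 then
  rcons (L m) (- (al 0%N)^-1 * \sum_(i < m.+1) al i.+1 * (L m)`_(m - i))
  else [:: (al 0%N)^-1].
have szL n : size (L n) = n.+1 by elim: n => //= n IH; rewrite size_rcons IH.
pose be n := (L n)`_n.
have LE m n : (n <= m)%N -> (L m)`_n = be n.
  elim: m => [|m IH]; first by rewrite leqn0 => /eqP ->.
  rewrite leq_eqVlt ltnS => /orP[/eqP-> //|nm].
  by rewrite /= nth_rcons szL ltnS nm IH.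
have beS n : be n.+1 = - (al 0%N)^-1 * \sum_(i < n.+1) al i.+1 * be (n - i)%N.
  rewrite {1}/be /= nth_rcons szL ltnn eqxx; congr (_ * _).
  by apply: eq_bigr => i _; rewrite LE ?leq_subr.
exists be; last first.
  rewrite cauchyC; apply/funext => -[|n].
    by rewrite /cauchy big_ord1 /be /= mulfV.
  rewrite /cauchy big_ord_recl subn0 beS mulrA mulrN mulfV // mulN1r.
  by rewrite addrC; apply/eqP; rewrite subr_eq0; apply/eqP/eq_bigr.
pose B := `|(al 0%N)^-1|; pose D := A + B * A ^+ 2 + B.
have B0 : 0 <= B by exact: normr_ge0.
have A0 : 0 <= A by rewrite (le_trans ler01).
have A20 : 0 <= A ^+ 2 by rewrite exprn_ge0.
have BA0 : 0 <= B * A ^+ 2 by rewrite mulr_ge0.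
have D0 : 0 <= D by rewrite /D !addr_ge0.
apply: (@geoW _ D) => // n; elim/ltn_ind: n => -[|n] IH.
  by rewrite expr1 /be /= -/B lerDr addr_ge0.
rewrite beS normrM normrN -/B.
apply: le_trans (_ : B * (A ^+ 2 * \sum_(i < n.+1) D ^+ (n.+1 - i) * A ^+ i) <= _).
  rewrite ler_wpM2l // mulr_sumr; apply: le_trans (ler_norm_sum _ _ _) _.
  apply: ler_sum => i _; rewrite normrM mulrCA mulrC -exprD.
  have -> : (n.+1 - i = (n - i).+1)%N by rewrite subSn // -ltnS.
  by apply: ler_pM => //; apply: IH; rewrite ltnS leq_subr.
under eq_bigr => i _ do rewrite subSn -1?ltnS // exprS -mulrA.
rewrite -mulr_sumr [A ^+ 2 * _]mulrCA [B * _]mulrCA [B * _]mulrA [leRHS]exprS.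
apply: ler_wpM2l => //.
have := subrXX D A n.+1; rewrite /=.
set S := \sum_(i < n.+1) _ => SE.
have S0 : 0 <= S by apply: sumr_ge0 => i _; rewrite mulr_ge0 ?exprn_ge0.
apply: le_trans (_ : (D - A) * S <= _); last first.
  by rewrite -SE lerBlDr lerDl exprn_ge0.
have -> : D - A = B * A ^+ 2 + B.
  by apply/eqP; rewrite subr_eq /D -addrA addrC.
by apply: ler_wpM2r => //; rewrite lerDl.
Qed.

Lemma conv_emb N k l al be : (0 < N)%N ->
  conv (emb N k al) (emb N l be) = emb N (k + l) (cauchy al be).
Proof.
move=> N0.
have pD i j : pexpo N k i + pexpo N l j = pexpo N (k + l) (i + j).
  by rewrite /pexpo -mulrDl -rmorphD /= PoszD addrACA.
have supp p q : emb N k al p * emb N l be (q - p) != 0 ->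
    exists i j, p = pexpo N k i /\ q = pexpo N (k + l) (i + j).
  rewrite mulf_eq0 negb_or => /andP[/emb_neq0[i ->] /emb_neq0[j qj]].
  by exists i, j; split=> //; rewrite -pD -qj addrC subrK.
apply: eq_emb => // [q|n].
  have [[j -> _]|nq] := pselect (exists j, q = pexpo N (k + l) j); first by exists j.
  rewrite /conv fsbig1 ?eqxx // => p _; apply/eqP/negPn/negP.
  by move=> /supp[i [j [_ qE]]]; apply: nq; exists (i + j)%N.
rewrite /conv /cauchy.
pose r := [seq pexpo N k i | i <- iota 0 n.+1].
have ur : uniq r by rewrite map_inj_uniq ?iota_uniq //; exact: pexpo_inj.
rewrite (fsbigE r) //; last first.
  move=> p _ pr; apply/eqP/negPn/negP => /supp[i [j [pE]]].
  move=> /(pexpo_inj N0) nE; move: pr; rewrite pE map_f //.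
  by rewrite mem_iota add0n ltnS nE leq_addr.
under eq_bigl do rewrite in_setT.
rewrite big_map -/(index_iota 0 n.+1) big_mkord; apply: eq_bigr => i _.
rewrite embE //; congr (_ * _).
have in_ : (i <= n)%N by rewrite -ltnS.
by rewrite -{1}(subnKC in_) -pD addrC addKr embE.
Qed.

Lemma is_cpuiseuxD a b : is_cpuiseux a -> is_cpuiseux b ->
  is_cpuiseux (fun q => a q + b q).
Proof.
move=> pa pb; have [N [k [al [be [N0 [gal gbe] -> ->]]]]] := puiseux2 pa pb.
apply/puiseuxP; exists N, k, (fun n => al n + be n); split=> //.
  exact: geoD.
apply/funext => q; rewrite /emb /=.
by case: ifP => // _; rewrite addr0.
Qed.

Lemma is_cpuiseuxN a : is_cpuiseux a -> is_cpuiseux (fun q => - a q).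
Proof.
move=> /puiseuxP[N [k [al [N0 gal ->]]]].
apply/puiseuxP; exists N, k, (fun n => - al n); split=> //.
  exact: geoN.
apply/funext => q; rewrite /emb /=.
by case: ifP => // _; rewrite oppr0.
Qed.

Lemma is_cpuiseuxM a b : is_cpuiseux a -> is_cpuiseux b ->
  is_cpuiseux (conv a b).
Proof.
move=> pa pb; have [N [k [al [be [N0 [gal gbe] -> ->]]]]] := puiseux2 pa pb.
rewrite (conv_emb _ _ _ _ N0); apply/puiseuxP.
exists N, (k + k), (cauchy al be); split; [exact: N0 | | by []].
exact: geo_cauchy.
Qed.

Lemma single_emb c k N : (0 < N)%N ->
  single c (k%:~R / N%:R) = emb N k (fun n => if n == 0%N then c else 0).
Proof.
move=> N0; have pE : k%:~R / N%:R = pexpo N k 0 by rewrite /pexpo addr0.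
rewrite pE; apply: eq_emb => // [q|j]; rewrite /single.
  by case: ifP => [/eqP-> _|_]; [exists 0%N | rewrite eqxx].
by rewrite (inj_eq (pexpo_inj N0)).
Qed.

Lemma is_cpuiseux_single c r : is_cpuiseux (single c r).
Proof.
have N0 : (0 < `|denq r|)%N by rewrite absz_gt0 denq_neq0.
apply/puiseuxP; exists `|denq r|%N, (numq r), (fun n => if n == 0%N then c else 0).
split=> //; first exact: geo_delta.
rewrite -single_emb //; congr (single _ _).
by rewrite pmulrn absz_denq divq_num_den.
Qed.

Lemma convC a b : is_cpuiseux a -> is_cpuiseux b -> conv a b = conv b a.
Proof.
move=> pa pb; have [N [k [al [be [N0 _ -> ->]]]]] := puiseux2 pa pb.
by rewrite !conv_emb // cauchyC.
Qed.

Lemma conv_empty a : conv (fun=> 0) a = fun=> 0.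
Proof. by apply/funext => q; rewrite /conv fsbig1 // => p _; rewrite mul0r. Qed.

Lemma puiseux3 a b c : is_cpuiseux a -> is_cpuiseux b -> is_cpuiseux c ->
  exists N k l al be ga, [/\ (0 < N)%N,
    a = emb N k al, b = emb N k be & c = emb N l ga].
Proof.
move=> pa pb /puiseuxP[M [l [ga [M0 gga ->]]]].
have [N [k [al [be [N0 [gal gbe] -> ->]]]]] := puiseux2 pa pb.
have [al' _ ->] := emb_scale k N0 M0 gal.
have [be' _ ->] := emb_scale k N0 M0 gbe.
have [ga' _ ->] := emb_scale l M0 N0 gga.
exists (N * M)%N, (k * M%:Z), (l * N%:Z), al', be', ga'.
by split=> //; [rewrite muln_gt0 N0 | rewrite mulnC].
Qed.

Lemma convA a b c : is_cpuiseux a -> is_cpuiseux b -> is_cpuiseux c ->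
  conv a (conv b c) = conv (conv a b) c.
Proof.
move=> pa pb pc.
have [N [k [l [al [be [ga [N0 -> -> ->]]]]]]] := puiseux3 pa pb pc.
by rewrite !conv_emb // cauchyA addrA.
Qed.

Lemma convDl a b c : is_cpuiseux a -> is_cpuiseux b -> is_cpuiseux c ->
  conv (fun q => a q + b q) c = fun q => conv a c q + conv b c q.
Proof.
move=> pa pb pc.
have [N [k [l [al [be [ga [N0 -> -> ->]]]]]]] := puiseux3 pa pb pc.
have embD k' x y :
    (fun q => emb N k' x q + emb N k' y q) = emb N k' (fun n => x n + y n).
  by apply/funext => q; rewrite /emb /=; case: ifP => // _; rewrite addr0.
rewrite embD !conv_emb // embD; congr (emb _ _ _); apply/funext => n.
by rewrite /cauchy -big_split; apply: eq_bigr => i _; rewrite mulrDl.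
Qed.

Lemma conv1 a : is_cpuiseux a -> conv (single 1 0) a = a.
Proof.
move=> /puiseuxP[N [k [al [N0 _ ->]]]].
have -> : (0 : rat) = 0%:~R / N%:R by rewrite mul0r.
rewrite single_emb // conv_emb // add0r; congr (emb _ _ _).
rewrite -[RHS]cauchy1; congr (cauchy _ _).
by apply/funext => -[|n].
Qed.

Lemma emb_first a : is_cpuiseux a -> (exists q, a q != 0) ->
  exists N k al, [/\ (0 < N)%N, geo al, al 0%N != 0 & a = emb N k al].
Proof.
move=> /puiseuxP[N [k [al [N0 gal ->]]]] [q /[dup] /emb_neq0[j ->]].
rewrite embE // => alj.
have ex : exists j, al j != 0 by exists j.
case: (ex_minnP ex) => n aln min_n.
exists N, (k + n%:Z), (fun i => al (i + n)%N); split=> //.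
  case: gal => A A1 alA; apply: (@geoW _ (A ^+ n.+1)) => [|i].
    by rewrite exprn_ge0 // (le_trans ler01).
  apply: le_trans (alA _) _; rewrite -exprM ler_weXn2l //.
  by rewrite addnC -addSn mulnS leq_add2l leq_pmull.
rewrite [RHS](emb_shift _ n _ N0) addrK; congr (emb _ _ _); apply/funext => i.
case: ltnP => [iln|nli]; last by rewrite subnK.
by apply/eqP/negPn/negP => /min_n; rewrite leqNgt iln.
Qed.

Lemma conv_inv a : is_cpuiseux a -> (exists q, a q != 0) ->
  exists2 b, is_cpuiseux b & conv b a = single 1 0.
Proof.
move=> pa a0; have [N [k [al [N0 gal al0 ->]]]] := emb_first pa a0.
have [be gbe beal] := cauchy_inv al0 gal.
exists (emb N (- k) be); first by apply/puiseuxP; exists N, (- k), be.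
rewrite conv_emb // beal addNr.
have -> : (0 : rat) = 0%:~R / N%:R by rewrite mul0r.
by rewrite single_emb //; congr (emb _ _ _); apply/funext => -[|n].
Qed.

Lemma cpuiseux_lowest a : is_cpuiseux a -> (exists q, a q != 0) ->
  exists q, a q != 0 /\ forall r, a r != 0 -> q <= r.
Proof.
move=> pa a0; have [N [k [al [N0 gal al0 ->]]]] := emb_first pa a0.
exists (pexpo N k 0); rewrite embE //; split=> // _ /emb_neq0[j ->].
rewrite /pexpo ler_pM2r ?invr_gt0 ?ltr0n // ler_int.
by rewrite addr0 lerDl.
Qed.

(* An element is recorded as its coefficient function q |-> [t^q]. *)
Record cpuiseux := CPuiseux {
  pcoef :> rat -> C;
  pcoef_subproof : `[< is_cpuiseux pcoef >] }.

HB.instance Definition _ := [isSub for pcoef].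
HB.instance Definition _ := [Choice of cpuiseux by <:].

Implicit Types x y z : cpuiseux.

Lemma pcoefP x : is_cpuiseux x.
Proof. by apply/asboolP; case: x. Qed.

Lemma cpuiseux_eq x y : (forall q, x q = y q) -> x = y.
Proof. by move=> xy; apply: val_inj; apply/funext. Qed.

Definition mk_cpuiseux a (pa : is_cpuiseux a) : cpuiseux :=
  CPuiseux (asboolT pa).

Definition psingle (c : C) (r : rat) : cpuiseux :=
  mk_cpuiseux (is_cpuiseux_single c r).

Definition padd x y : cpuiseux :=
  mk_cpuiseux (is_cpuiseuxD (pcoefP x) (pcoefP y)).

Definition popp x : cpuiseux := mk_cpuiseux (is_cpuiseuxN (pcoefP x)).

Definition pmul x y : cpuiseux :=
  mk_cpuiseux (is_cpuiseuxM (pcoefP x) (pcoefP y)).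

Fact paddA : associative padd.
Proof. by move=> x y z; apply: cpuiseux_eq => q /=; rewrite addrA. Qed.

Fact paddC : commutative padd.
Proof. by move=> x y; apply: cpuiseux_eq => q /=; rewrite addrC. Qed.

Let single0 q : single 0 0 q = 0.
Proof. by rewrite /single; case: eqP. Qed.

Fact padd0 : left_id (psingle 0 0) padd.
Proof. by move=> x; apply: cpuiseux_eq => q; rewrite /= single0 add0r. Qed.

Fact paddN : left_inverse (psingle 0 0) popp padd.
Proof. by move=> x; apply: cpuiseux_eq => q; rewrite /= single0 addNr. Qed.

HB.instance Definition _ := GRing.isZmodule.Build cpuiseux
  paddA paddC padd0 paddN.

Fact pmulA : associative pmul.
Proof.
move=> x y z; apply: val_inj.
exact: (convA (pcoefP x) (pcoefP y) (pcoefP z)).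
Qed.

Fact pmulC : commutative pmul.
Proof. by move=> x y; apply: val_inj; exact: (convC (pcoefP x) (pcoefP y)). Qed.

Fact pmul1 : left_id (psingle 1 0) pmul.
Proof. by move=> x; apply: val_inj; exact: (conv1 (pcoefP x)). Qed.

Fact pmulDl : left_distributive pmul padd.
Proof.
move=> x y z; apply: val_inj.
exact: (convDl (pcoefP x) (pcoefP y) (pcoefP z)).
Qed.

Fact pone_neq0 : psingle 1 0 != 0.
Proof.
apply/eqP => /(congr1 (fun x : cpuiseux => x 0)); rewrite /= single0 /single.
by rewrite eqxx; apply/eqP; exact: oner_neq0.
Qed.

HB.instance Definition _ := GRing.Zmodule_isComNzRing.Build cpuiseux
  pmulA pmulC pmul1 pmulDl pone_neq0.

Lemma cpuiseux_neq0 x : x != 0 -> exists q, x q != 0.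
Proof.
move=> x0; apply: contrapT => nx; move/eqP: x0; apply.
apply: cpuiseux_eq => q; rewrite /= single0; apply/eqP/negPn/negP => xq.
by apply: nx; exists q.
Qed.

Definition pinv x : cpuiseux := xget 0 [set y | y * x = 1].

Fact pmulV x : x != 0 -> pinv x * x = 1.
Proof.
move=> x0; apply: (@xgetPex _ 0 [set y | y * x = 1]).
have [b pb bx] := conv_inv (pcoefP x) (cpuiseux_neq0 x0).
by exists (mk_cpuiseux pb); apply: val_inj.
Qed.

Fact pinv0 : pinv 0 = 0.
Proof.
apply: xgetPN => y /=; rewrite mulr0 => /eqP.
by rewrite eq_sym oner_eq0.
Qed.

HB.instance Definition _ := GRing.ComNzRing_isField.Build cpuiseux pmulV pinv0.

Definition pconst (c : C) : cpuiseux := psingle c 0.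

(* t^r *)
Definition ppow (r : rat) : cpuiseux := psingle 1 r.

(* The valuation, with the dummy value 0 at x = 0. *)
Definition pval x : rat :=
  xget 0 [set q | x q != 0 /\ forall r, x r != 0 -> q <= r].

Lemma pvalP x : x != 0 ->
  x (pval x) != 0 /\ forall r, x r != 0 -> pval x <= r.
Proof.
by move=> x0; exact: xgetPex (cpuiseux_lowest (pcoefP x) (cpuiseux_neq0 x0)).
Qed.

End Series.

Section Laurent.
Variables (K : comNzRingType) (n : nat).
Local Notation mon := 'rV[int]_n.

(* K[x_1^(+-1), ..., x_n^(+-1)]: finitely supported families of coefficients
   indexed by the exponents in Z^n, with the convolution product.            *)
Record laurent := Laurent { lcoef :> {fsfun mon -> K with 0} }.

HB.instance Definition _ := [isNew for lcoef].
HB.instance Definition _ := [Choice of laurent by <:].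

Implicit Types (f g h : laurent) (u v w : mon).

Lemma laurent_eq f g : (forall u, f u = g u) -> f = g.
Proof. by move=> fg; apply: val_inj; apply/fsfunP. Qed.

Definition ladd f g := Laurent
  [fsfun u in (finsupp f `|` finsupp g)%fset => f u + g u].

Definition lopp f := Laurent [fsfun u in finsupp f => - f u].

Definition lmul f g := Laurent
  [fsfun u in [fset (v + w)%R | v in finsupp f, w in finsupp g]%fset =>
     \sum_(v <- finsupp f) f v * g (u - v)].

Definition lmonom (c : K) (u : mon) := Laurent [fsfun v in [fset u]%fset => c].

Lemma laddE f g u : ladd f g u = f u + g u.
Proof.
rewrite fsfunE in_fsetU; case: (finsuppP f); case: (finsuppP g) => //=.
by rewrite addr0.
Qed.

Lemma loppE f u : lopp f u = - f u.
Proof. by rewrite fsfunE; case: (finsuppP f) => //; rewrite oppr0. Qed.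

Lemma lmonomE c u v : lmonom c u v = if v == u then c else 0.
Proof. by rewrite fsfunE inE. Qed.

Lemma lmulE f g u : lmul f g u = \sum_(v \in [set: mon]) f v * g (u - v).
Proof.
rewrite (@fsbigTE _ _ _ _ (finsupp f)) => [|v /fsfun_dflt ->]; last by rewrite mul0r.
rewrite fsfunE; case: ifP => // /negP uN.
rewrite big_seq big1 // => v vf.
have [gv|gv] := boolP (u - v \in finsupp g); last by rewrite (fsfun_dflt gv) mulr0.
case: uN; apply/imfset2P; exists v => //; exists (u - v) => //.
by rewrite addrC subrK.
Qed.

Fact laddA : associative ladd.
Proof. by move=> f g h; apply: laurent_eq => u; rewrite !laddE addrA. Qed.

Fact laddC : commutative ladd.
Proof. by move=> f g; apply: laurent_eq => u; rewrite !laddE addrC. Qed.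

Fact ladd0 : left_id (lmonom 0 0) ladd.
Proof.
by move=> f; apply: laurent_eq => u; rewrite laddE lmonomE if_same add0r.
Qed.

Fact laddN : left_inverse (lmonom 0 0) lopp ladd.
Proof.
by move=> f; apply: laurent_eq => u; rewrite laddE loppE lmonomE if_same addNr.
Qed.

HB.instance Definition _ := GRing.isZmodule.Build laurent
  laddA laddC ladd0 laddN.

Let lsumE f g u (D : {fset mon}) : (finsupp f `<=` D)%fset ->
  lmul f g u = \sum_(v <- D) f v * g (u - v).
Proof.
move=> /fsubsetP fD; rewrite lmulE (@fsbigTE _ _ _ _ D) // => v vD.
by rewrite fsfun_dflt ?mul0r //; apply: contra vD; exact: fD.
Qed.

Fact lmulC : commutative lmul.
Proof.
move=> f g; apply: laurent_eq => u; rewrite !lmulE.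
rewrite (@reindex_fsbigT _ _ _ _ _ (fun v => u - v)); last first.
  by exists (fun v => u - v) => v; rewrite subKr.
by apply: eq_fsbigr => v _; rewrite subKr mulrC.
Qed.

Fact lmulDl : left_distributive lmul ladd.
Proof.
move=> f g h; apply: laurent_eq => u; rewrite laddE.
pose D := (finsupp f `|` finsupp g `|` finsupp (ladd f g))%fset.
have fD : (finsupp f `<=` D)%fset by rewrite /D -fsetUA fsubsetUl.
have gD : (finsupp g `<=` D)%fset by rewrite /D fsetUAC fsubsetUr.
have fgD : (finsupp (ladd f g) `<=` D)%fset by exact: fsubsetUr.
rewrite (lsumE _ _ fD) (lsumE _ _ gD) (lsumE _ _ fgD) -big_split /=.
by apply: eq_bigr => v _; rewrite laddE mulrDl.
Qed.

Fact lmul1 : left_id (lmonom 1 0) lmul.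
Proof.
move=> f; apply: laurent_eq => u.
have sD : (finsupp (lmonom 1 0) `<=` [fset 0%R])%fset.
  apply/fsubsetP => v; rewrite mem_finsupp lmonomE inE.
  by case: ifP => //; rewrite eqxx.
by rewrite (lsumE _ _ sD) big_seq_fset1 lmonomE eqxx mul1r subr0.
Qed.

Fact lmulA : associative lmul.
Proof.
move=> f g h; apply: laurent_eq => u.
pose D := ([fset (v + w)%R | v in finsupp f, w in finsupp g] `|`
  finsupp (lmul f g))%fset.
have DS : (finsupp (lmul f g) `<=` D)%fset by exact: fsubsetUr.
rewrite (lsumE _ _ (fsubset_refl _)) [RHS](lsumE _ _ DS).
under [RHS]eq_bigr => x _ do rewrite (lsumE _ _ (fsubset_refl _)) mulr_suml.
rewrite exchange_big /=; apply: eq_big_seq => v vf.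
under [RHS]eq_bigr => x _ do rewrite -mulrA.
rewrite -mulr_sumr; congr (_ * _); rewrite lmulE.
rewrite -(@fsbigTE _ _ _ _ D (fun x => g (x - v) * h (u - x))); last first.
  move=> x xD; rewrite fsfun_dflt ?mul0r //; apply: contra xD => gx.
  rewrite in_fsetU; apply/orP; left; apply/imfset2P.
  by exists v => //; exists (x - v) => //; rewrite addrC subrK.
rewrite [RHS](@reindex_fsbigT _ _ _ _ _ (fun w => w + v)); last first.
  by exists (fun w => w - v) => w; rewrite ?addrK ?subrK.
by apply: eq_fsbigr => w _; rewrite addrK opprD addrA addrAC.
Qed.

Fact lone_neq0 : lmonom 1 0 != 0.
Proof.
apply/eqP => /(congr1 (fun f : laurent => f 0)); rewrite !lmonomE eqxx.
by apply/eqP; exact: oner_neq0.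
Qed.

HB.instance Definition _ := GRing.Zmodule_isComNzRing.Build laurent
  lmulA lmulC lmul1 lmulDl lone_neq0.

Definition lconst (c : K) : laurent := lmonom c 0.

Definition lvar (i : 'I_n) : laurent := lmonom 1 (delta_mx 0 i).

End Laurent.

Definition ideal_gen (A : comNzRingType) (T : set A) : set A :=
  [set f | exists2 s : seq (A * A),
     (forall p, p \in s -> T p.2) & f = \sum_(p <- s) p.1 * p.2].

Section Tropical.
Variables (R : realType) (n : nat).
Local Notation LP := (laurent (cpuiseux R) n).
Implicit Types (f : LP) (w : 'rV[R]_n) (u v : 'rV[int]_n).

Definition trop_term f w u : R :=
  ratr (pval (f u)) + \sum_i (u 0 i)%:~R * w 0 i.

(* trop(f)(w); the minimum over the empty support of f = 0 is +oo. *)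
Definition trop f w : \bar R :=
  \big[Order.min/+oo%E]_(u <- finsupp f) (trop_term f w u)%:E.

(* trop(V(f)): the minimum is attained at least twice. By convention
   trop(V(0)), where V(0) is the whole torus, is the whole space.    *)
Definition trop_hypersurface f : set 'rV[R]_n :=
  [set w | f = 0 \/
     exists u v, [/\ u != v, u \in finsupp f, v \in finsupp f,
       (trop_term f w u)%:E = trop f w & (trop_term f w v)%:E = trop f w]].

(* trop(X) for X = V(I) in the torus: by definition it is computed from the
   ideal I.                                                                *)
Definition trop_variety (I : set LP) : set 'rV[R]_n :=
  \bigcap_(f in I) trop_hypersurface f.

Definition tropical_basis (T I : set LP) :=
  [/\ finite_set T, ideal_gen T = I &
      trop_variety I = \bigcap_(f in T) trop_hypersurface f].

End Tropical.

Definition wronskian (A : nzRingType) (p q : {poly A}) : {poly A} :=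
  p * q^`() - q * p^`().

Section BetheSystem.
Variables (R : realType) (m n : nat).
Local Notation L := (cpuiseux R).
Local Notation LP := (laurent L (m + n)).

(* x_1, ..., x_m are the first m variables and y_1, ..., y_n the last n. *)
Definition qplus : {poly LP} :=
  \prod_(i < m) ('X + (lvar L (lshift n i))%:P).

Definition qminus : {poly LP} :=
  \prod_(j < n) ('X + (lvar L (rshift m j))%:P).

Definition esym (k : nat) : LP :=
  \sum_(A : {set 'I_(m + n)} | #|A| == k) \prod_(i in A) lvar L i.

(* p_(k-1): note the shift of index. *)
Definition wr_coef (k : nat) : LP := (wronskian qplus qminus)`_(m + n - k).

Definition bethe_poly (d : nat -> R[i]) (k : nat) : LP :=
  esym k + lconst (m + n) (ppow R 1) * wr_coef k
  - lconst (m + n) (pconst (d k)).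

End BetheSystem.

(* Main.v *)
Require Import Defs.
From HB Require Import structures.
From mathcomp Require Import all_boot all_order all_algebra finmap complex.
From mathcomp Require Import mathcomp_extra boolp classical_sets functions.
From mathcomp Require Import cardinality fsbigop reals ereal topology.
From mathcomp Require Import normedtype sequences.
From mathcomp Require Import -(notations) ssrcomplements mpoly.

Set Implicit Arguments.
Unset Strict Implicit.
Unset Printing Implicit Defensive.

Import Order.TTheory GRing.Theory Num.Theory.

Local Open Scope ring_scope.

Local Notation "''x_' i" := (mpolyX _ (mnm1 i))
  (at level 8, i at level 2, format "''x_' i").

(** Write M = m + n, let O be the ring of convergent Puiseux series without
    negative exponents and I the ideal of f_1, ..., f_M.  Trivially trop(V(I))
    lies in the intersection of the hypersurfaces trop(V(f_k)), so it is
    enough to show that this intersection is contained in {0} and that 0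
    belongs to trop(V(I)).

    The intersection is contained in {0} (trop_prevariety_origin).  Expanding
    the Wronskian as a signed sum, over the variables x_j, of the products of
    all the factors z + x_i except i = j shows that every monomial of f_k is
    squarefree: it is x_B for a set B of variables.  Its coefficient is 1 when
    B has k elements, is -d_k modulo t when B is empty, and is divisible by t
    otherwise.  If w has r > 0 negative coordinates, then the product of the
    corresponding variables has the least weight of all squarefree monomials,
    and it is the only one of degree r with that weight; the other monomials
    of f_r are constant, hence of nonnegative weight, or carry a factor t, so
    the minimum is attained only once.  If w is nonnegative and not 0, the minimum of f_M is attained only
    at the constant term, because d_M is not 0.

    The origin belongs to trop(V(I)) (origin_in_trop_variety).  Otherwise some
    g in I has a unique coefficient of least valuation; after multiplication
    by a monomial and a power of t, it becomes a polynomial P in O[x] whose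
    residue is a nonzero multiple of a single monomial.  Since the complex
    numbers are algebraically closed, there is a complex point z with
    e_k(z) = d_k for all k, and its coordinates are not 0 as d_M is not 0; so
    P(z) has a nonzero residue.  But f_k(z) is divisible by t, hence P(z) has
    residue 0 as soon as the cofactors of P can be chosen in O[x].

    This last point is the heart of the proof: an element of O[x] in the ideal
    generated by the f_k over the field is in the ideal generated over O
    (span_over_symmetric).  It holds because the leading form of f_k is e_k.
    A unitriangular change of generators replaces the e_k by the complete
    homogeneous symmetric polynomials in the last variables, whose leading
    monomials are powers of distinct variables; for such generators
    g_1, ..., g_M the products of powers of the g_i and of reduced monomials
    form a basis of the polynomial ring over every ring of coefficients, in
    which the ideal is spanned by a part of the basis (span_over_triangular).
    No lifting of z to a point of V(I) is involved, so multiple roots of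
    Lambda need no special treatment. *)

(** * Triangular systems: leading monomials *)

Section Below.
Variables (K : comNzRingType) (n : nat).
Local Notation P := (mpoly n K).
Implicit Types (a b : multinom n) (p q : P).

(** Leading monomials, for the graded lexicographic order, are expressed by
    vanishing coefficients rather than by mlead: this covers p = 0 and makes
    lower order terms closed under addition. *)
Definition below a p := forall b, (a <= b)%O -> mcoeff b p = 0.

Definition monic_at a p := below a (p - mpolyX K a).

Lemma below0 a : below a 0.
Proof. by move=> b _; rewrite mcoeff0. Qed.

Lemma belowD a p q : below a p -> below a q -> below a (p + q).
Proof. by move=> pa qa b ab; rewrite mcoeffD pa // qa // addr0. Qed.

Lemma belowZ c a p : below a p -> below a (c *: p).
Proof. by move=> pa b ab; rewrite mcoeffZ pa // mulr0. Qed.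

Lemma below_sum a (I : eqType) (s : seq I) (F : I -> P) :
  (forall i, i \in s -> below a (F i)) -> below a (\sum_(i <- s) F i).
Proof.
move=> Fa; rewrite big_seq; apply: (big_ind (below a)) => //.
- exact: below0.
- exact: belowD.
Qed.

Lemma belowX a b : (b < a)%O -> below a (mpolyX K b).
Proof.
move=> ba c ac; rewrite mcoeffX; case: eqP => // bc.
by move: (lt_le_trans ba ac); rewrite bc ltxx.
Qed.

Lemma below_trans a b p : (a <= b)%O -> below a p -> below b p.
Proof. by move=> ab pa c bc; apply: pa; apply: le_trans bc. Qed.

Lemma monic_at_below a b p : (a < b)%O -> monic_at a p -> below b p.
Proof.
move=> ab /(below_trans (ltW ab)) pa.
by rewrite -(subrK (mpolyX K a) p); apply: belowD pa (belowX ab).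
Qed.

Lemma monic_atX a : monic_at a (mpolyX K a).
Proof. by rewrite /monic_at subrr; exact: below0. Qed.

Lemma below_mul a b p q : below a p ->
  (forall c, (b < c)%O -> mcoeff c q = 0) -> below (mnm_add a b) (p * q).
Proof.
move=> pa qb c abc; rewrite mcoeffM big1 // => k /eqP ck.
have [/pa->|ka] := leP a k.1; first by rewrite mul0r.
have [/qb->|kb] := ltP b k.2; first by rewrite mulr0.
by move: (ltmc_le_add ka kb); rewrite -ck ltNge abc.
Qed.

Lemma monic_atM a b p q :
  monic_at a p -> monic_at b q -> monic_at (mnm_add a b) (p * q).
Proof.
move=> pa qb; rewrite /monic_at.
have -> : p * q - mpolyX K (mnm_add a b) =
    (p - mpolyX K a) * q + mpolyX K a * (q - mpolyX K b).
  by rewrite mulrBl mulrBr -mpolyXD addrA subrK.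
apply: belowD.
  apply: below_mul pa _ => c bc; exact: monic_at_below bc qb _ (lexx c).
rewrite addmC mulrC; apply: below_mul qb _ => c ac.
exact: belowX ac _ (lexx c).
Qed.

Lemma monic_at1 : monic_at (mnm0 (n:=n)) 1.
Proof. by rewrite -mpolyX0; exact: monic_atX. Qed.

Lemma monic_atXn a p k : monic_at a p -> monic_at (mnm_muln a k) (p ^+ k).
Proof.
move=> pa; elim: k => [|k IH]; first by rewrite mulm0n expr0; exact: monic_at1.
by rewrite mulmS exprS; exact: monic_atM.
Qed.

Lemma monic_at_prod (F : 'I_n -> P) (k : 'I_n -> multinom n) :
  (forall i, monic_at (k i) (F i)) ->
  monic_at (\big[@mnm_add n/mnm0 (n:=n)]_i k i) (\prod_i F i).
Proof.
move=> H; apply: (big_ind2 monic_at) => //; first exact: monic_at1.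
by move=> *; exact: monic_atM.
Qed.

End Below.

Section Recombine.
Variables (K : comNzRingType) (n : nat).
Local Notation P := (mpoly n K).
Implicit Types (a b m : multinom n) (p q c : P).

Variable G : multinom n -> P.
Hypothesis G_monic : forall m, monic_at m (G m).

(** The change of basis x^m |-> G m, extended linearly.  It is unitriangular
    for the monomial order, hence bijective. *)
Definition recomb c : P := \sum_(m <- msupp c) mcoeff m c *: G m.

(** Summing over all monomials of bounded degree, instead of over the support,
    gives a common range for the sums attached to several polynomials. *)
Lemma recombE k c : (msize c <= k)%N ->
  recomb c = \sum_(m : bmultinom n k) mcoeff m c *: G m.
Proof.
move=> le_pi; set I : subFinType _ := bmultinom n k.
rewrite /recomb (big_mksub I) ?msupp_uniq //=; first last.
  by move=> x /msize_mdeg_lt /leq_trans; apply.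
rewrite big_rmcond //= => j /memN_msupp_eq0 ->.
by rewrite scale0r.
Qed.

Lemma recombD p q : recomb (p + q) = recomb p + recomb q.
Proof.
pose k := maxn (msize (p + q)) (maxn (msize p) (msize q)).
rewrite !(@recombE k) ?leq_max ?leqnn ?orbT // -big_split /=.
by apply: eq_bigr => i _; rewrite mcoeffD scalerDl.
Qed.

Lemma recombZX x m : recomb (x *: mpolyX K m) = x *: G m.
Proof.
pose k := maxn (msize (x *: mpolyX K m)) (mdeg m).+1.
have mk : (mdeg m < k)%N by rewrite leq_max leqnn orbT.
rewrite (@recombE k) ?leq_max ?leqnn //.
rewrite (bigD1 (BMultinom mk)) //= big1 => [|i /eqP ik].
  by rewrite addr0 mcoeffZ mcoeffX eqxx mulr1.
rewrite mcoeffZ mcoeffX; case: eqP => [mi|_]; last by rewrite mulr0 scale0r.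
by case: ik; apply: val_inj.
Qed.

Lemma recomb0 : recomb 0 = 0.
Proof. by rewrite /recomb msupp0 big_nil. Qed.

Lemma recomb_sum (I : Type) (s : seq I) (F : I -> P) :
  recomb (\sum_(i <- s) F i) = \sum_(i <- s) recomb (F i).
Proof. exact: (big_morph recomb recombD recomb0). Qed.

Lemma recombN p : recomb (- p) = - recomb p.
Proof. by apply/eqP; rewrite -addr_eq0 -recombD addNr recomb0. Qed.

(** The leading coefficient of c is also the coefficient of the same monomial
    in recomb c. *)
Lemma recomb_eq0 c : recomb c = 0 -> c = 0.
Proof.
move=> c0; apply/eqP; rewrite -mleadc_eq0; apply/eqP.
have : below (mlead c) (recomb c - c).
  rewrite {3}[c]mpolyE /recomb -sumrB; apply: below_sum => m mc.
  by rewrite -scalerBr; apply/belowZ/below_trans/G_monic/msupp_le_mlead.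
move=> /(_ _ (lexx _)); rewrite c0 add0r mcoeffN => /eqP.
by rewrite oppr_eq0 => /eqP.
Qed.

Lemma recomb_inj : injective recomb.
Proof.
move=> p q pq; apply/eqP; rewrite -subr_eq0; apply/eqP/recomb_eq0.
by rewrite recombD recombN pq subrr.
Qed.

(** Subtracting from p its leading coefficient times the corresponding G a
    lowers the leading monomial.  As no division occurs, the coefficients stay
    in any subring S that contains those of p and of the G m. *)
Lemma recomb_surj (S : subringClosed K) p :
  (forall m, G m \is a mpolyOver n S) -> p \is a mpolyOver n S ->
  exists2 c, c \is a mpolyOver n S & recomb c = p.
Proof.
move=> GS; move: {2}(mlead p) (lexx (mlead p)) => a.
elim/(@ltmwf n): a p => a IH p pa pS.
pose q := p - mcoeff a p *: G a.
have qS : q \is a mpolyOver n S.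
  by rewrite rpredB // mpolyOverZ //; exact: (mpolyOverP _ pS).
have qa : below a q.
  move=> b; rewrite mcoeffB mcoeffZ le_eqVlt => /orP[/eqP<-|ab].
    have /(_ a (lexx a)) := @G_monic a; rewrite mcoeffB mcoeffX eqxx => /eqP.
    by rewrite subr_eq0 => /eqP->; rewrite mulr1 subrr.
  rewrite mcoeff_gt_mlead ?(le_lt_trans pa) //.
  by rewrite (monic_at_below ab (@G_monic a) (lexx b)) mulr0 subrr.
have [c cS cq] : exists2 c, c \is a mpolyOver n S & recomb c = q.
  have [->|q0] := eqVneq q 0; first by exists 0; rewrite ?rpred0 ?recomb0.
  apply: (IH (mlead q)) => //; rewrite ltNge; apply/negP => /qa/eqP.
  by rewrite mleadc_eq0 (negPf q0).
exists (c + mcoeff a p *: mpolyX K a).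
  rewrite rpredD // mpolyOverZ ?mpolyOverX //; exact: (mpolyOverP _ pS).
by rewrite recombD recombZX cq subrK.
Qed.

End Recombine.

(** * Purity of ideals of triangular systems *)

Section Span.
Variables (K : comNzRingType) (n : nat) (I : finType).
Local Notation P := (mpoly n K).

(** Membership in the ideal of f with cofactors in S[x].  For S = predT this
    is the ideal generated over K. *)
Definition span_over (S : {pred K}) (f : I -> P) (p : P) :=
  exists2 q : I -> P, (forall i, q i \is a mpolyOver n S) & p = \sum_i q i * f i.

Variables (S : subringClosed K).

Lemma span_over0 f : span_over S f 0.
Proof.
exists (fun=> 0) => [i|]; first exact: rpred0.
by rewrite big1 // => i _; rewrite mul0r.
Qed.

Lemma span_overD f p q : span_over S f p -> span_over S f q ->
  span_over S f (p + q).
Proof.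
move=> [p' p'S ->] [q' q'S ->]; exists (fun i => p' i + q' i) => [i|].
  exact: rpredD.
by rewrite -big_split; apply: eq_bigr => i _; rewrite mulrDl.
Qed.

Lemma span_overM f p q : q \is a mpolyOver n S -> span_over S f p ->
  span_over S f (q * p).
Proof.
move=> qS [p' p'S ->]; exists (fun i => q * p' i) => [i|].
  exact: rpredM.
by rewrite mulr_sumr; apply: eq_bigr => i _; rewrite mulrA.
Qed.

Lemma span_overN f p : span_over S f p -> span_over S f (- p).
Proof. by rewrite -mulN1r; apply: span_overM; rewrite rpredN rpred1. Qed.

Lemma span_over_gen f i : span_over S f (f i).
Proof.
exists (fun j => (j == i)%:R) => [j|]; first exact: rpred_nat.
rewrite (bigD1 i) //= eqxx mul1r big1 ?addr0 // => j /negPf->.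
by rewrite mul0r.
Qed.

Lemma span_over_sum f (J : eqType) (s : seq J) (F : J -> P) :
  (forall j, j \in s -> span_over S f (F j)) ->
  span_over S f (\sum_(j <- s) F j).
Proof.
move=> Ff; rewrite big_seq; apply: (big_ind (span_over S f)) => //.
- exact: span_over0.
- exact: span_overD.
Qed.

Lemma span_over_trans f g p : (forall i, span_over S g (f i)) ->
  span_over S f p -> span_over S g p.
Proof.
move=> fg [q qS ->]; apply: span_over_sum => i _.
by apply: span_overM; [exact: qS | exact: fg].
Qed.

End Span.

(** Makes the lemmas on span_over available for the ideal generated over K. *)
Fact predT_subring_closed (K : comNzRingType) :
  subring_closed (predT : {pred K}).
Proof. by split. Qed.

HB.instance Definition _ (K : comNzRingType) :=
  GRing.isSubringClosed.Build K predT (@predT_subring_closed K).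

Section Pure.
Variables (K : comNzRingType) (n : nat) (S : subringClosed K).
Local Notation P := (mpoly n K).
Variables (g : 'I_n -> P) (e : 'I_n -> nat).
Hypothesis e_gt0 : forall i, (0 < e i)%N.
Hypothesis g_monic : forall i, monic_at (mnm_muln (mnm1 i) (e i)) (g i).
Hypothesis gS : forall i, g i \is a mpolyOver n S.

(** Euclidean division of each exponent of x^m by e_i distributes it between
    g_i and x_i, so that G m has leading monomial x^m, each monomial being
    obtained once. *)
Let G (m : multinom n) : P :=
  \prod_i (g i ^+ (m i %/ e i) * mpolyX K (mnm1 i) ^+ (m i %% e i)).

Let G_monic m : monic_at m (G m).
Proof.
have {1}-> : m = \big[@mnm_add n/mnm0 (n:=n)]_i
    mnm_add (mnm_muln (mnm_muln (mnm1 i) (e i)) (m i %/ e i))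
            (mnm_muln (mnm1 i) (m i %% e i)).
  rewrite [LHS]multinomUE_id; apply: eq_bigr => i _.
  rewrite {1}(divn_eq (m i) (e i)); apply/mnmP => j.
  by rewrite mnmDE !mulmnE mulnDr mulnA mulnAC.
apply: monic_at_prod => i; apply: monic_atM; apply: monic_atXn => //.
exact: monic_atX.
Qed.

Let GS m : G m \is a mpolyOver n S.
Proof. by apply: rpred_prod => i _; rewrite rpredM ?rpredX // mpolyOverX. Qed.

Let G_shift m i : G (mnm_add m (mnm_muln (mnm1 i) (e i))) = g i * G m.
Proof.
rewrite /G (bigD1 i) //= [in RHS](bigD1 i) //= !mulrA -exprS.
rewrite mnmDE mulmnE mnm1E eqxx mul1n divnDr // modnDr divnn e_gt0 addn1.
congr (_ * _); apply: eq_bigr => j /negPf ji.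
by rewrite mnmDE mulmnE mnm1E eq_sym ji mul0n addn0.
Qed.

(** Multiplication by g_i is, in the basis G, multiplication by the monomial
    x_i^(e_i): the ideal of g corresponds to a monomial ideal. *)
Let recomb_shift i c :
  recomb G (mpolyX K (mnm_muln (mnm1 i) (e i)) * c) = g i * recomb G c.
Proof.
rewrite [c in LHS]mpolyE mulr_sumr recomb_sum mulr_sumr.
apply: eq_bigr => m _; rewrite -scalerAr -mpolyXD recombZX addmC G_shift.
by rewrite scalerAr.
Qed.

(** The unique expression of p in the basis G has its coefficients in S since
    p has, and involves only basis elements with a factor g_i since p is in
    the ideal. *)
Lemma span_over_triangular p (q : 'I_n -> P) : p \is a mpolyOver n S ->
  p = \sum_i q i * g i -> span_over S g p.
Proof.
move=> pS pE.
have [c cS cp] := recomb_surj G_monic GS pS.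
have [c' c'E] : exists c', forall i, recomb G (c' i) = q i.
  suff H i : exists c0, recomb G c0 = q i by exact: fin_all_exists H.
  have [m|| c0 _ <-] := @recomb_surj _ _ _ G_monic predT (q i); last by exists c0.
    by apply/mpolyOverP.
  by apply/mpolyOverP.
have cE : c = \sum_i mpolyX K (mnm_muln (mnm1 i) (e i)) * c' i.
  apply: (recomb_inj G_monic); rewrite cp pE recomb_sum.
  by apply: eq_bigr => i _; rewrite recomb_shift c'E mulrC.
rewrite -cp; apply: span_over_sum => m mc.
rewrite -mul_mpolyC; apply: span_overM.
  by rewrite mpolyOverC (mpolyOverP _ cS).
have [i im] : exists i, (e i <= m i)%N.
  apply/existsP; apply: contraLR mc; rewrite negb_exists => /forallP me.
  rewrite -mcoeff_eq0 cE raddf_sum big1 //= => i _.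
  rewrite mulrC mcoeffM big1 // => k mk.
  rewrite mcoeffX; case: eqP => [ke|_]; last by rewrite mulr0.
  case/negP: (me i); move/eqP/(congr1 (fun a : multinom n => a i)): mk => ->.
  by rewrite mnmDE -ke mulmnE mnm1E eqxx mul1n leq_addl.
have -> : m = mnm_add (mnm_sub m (mnm_muln (mnm1 i) (e i))) (mnm_muln (mnm1 i) (e i)).
  apply/esym/submK/mnm_lepP => j; rewrite mulmnE mnm1E.
  by case: eqP => [<-|_]; rewrite ?mul1n ?mul0n.
by rewrite G_shift mulrC; apply: span_overM => //; exact: span_over_gen.
Qed.

End Pure.

(** * Systems whose leading forms are the elementary symmetric polynomials *)

Definition elem_sym (A : comNzRingType) (I : finType) (x : I -> A) k : A :=
  \sum_(J : {set I} | #|J| == k) \prod_(i in J) x i.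

Section PowerSeriesDivision.
Variable A : comNzRingType.
Implicit Types (x : A) (s : seq A) (u v c : nat -> A) (N : nat).

(** The quotient of the power series with coefficients v by 1 - x z. *)
Fixpoint sdiv x v N := v N + (if N is N'.+1 then x * sdiv x v N' else 0).

Definition sdivs s v := foldr sdiv v s.

(** Multiplying back by 1 - x z. *)
Lemma sdiv_prev x v N :
  v N = sdiv x v N - (if N is N'.+1 then x * sdiv x v N' else 0).
Proof. by case: N => [|N] /=; rewrite ?addr0 ?subr0 ?addrK. Qed.

Lemma sdivs0 s v : sdivs s v 0%N = v 0%N.
Proof. by elim: s => //= x s IH; rewrite addr0 IH. Qed.

Lemma sdivs_closed (Q : A -> Prop) s v :
  (forall a b, Q a -> Q b -> Q (a + b)) -> Q 0 ->
  (forall x a, x \in s -> Q a -> Q (x * a)) ->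
  (forall N, Q (v N)) -> forall N, Q (sdivs s v N).
Proof.
move=> QD Q0; elim: s => //= x s IH QM Qv N.
have Qs := IH (fun y a ys => QM y a (mem_behead (s := x :: s) ys)) Qv.
by elim: N => [|N IHN] /=; apply: QD => //; apply: QM; rewrite ?mem_head.
Qed.

Definition linprod s : {poly A} := \prod_(x <- s) (1 - x *: 'X).

Lemma size_linprod s : (size (linprod s) <= (size s).+1)%N.
Proof.
rewrite /linprod; elim: s => [|x s IH]; first by rewrite big_nil size_poly1.
rewrite big_cons; apply: leq_trans (size_polyMleq _ _) _.
have h : (size (1 - x *: 'X)%R <= 2)%N.
  apply: leq_trans (size_polyD _ _) _; rewrite size_polyN size_poly1 geq_max /=.
  by apply: leq_trans (size_scale_leq _ _) _; rewrite size_polyX.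
by rewrite -subn1 leq_subLR; apply: leq_trans (leq_add h IH) _.
Qed.

(** Dividing the product of the factors 1 - x z for x in s' ++ s by those for
    x in s leaves the product over s', and division is linear. *)
Lemma sdivs_linprod s' s v c :
  (forall N, v N = c N - (linprod (s' ++ s))`_N) ->
  forall N, sdivs s v N = sdivs s c N - (linprod s')`_N.
Proof.
elim: s s' => [|x s IH] s' vc; first by move=> N; rewrite /= vc cats0.
have H N : sdivs s v N = sdivs s c N - ((linprod s')`_N -
    (if N is N'.+1 then x * (linprod s')`_N' else 0)).
  rewrite (IH (rcons s' x)) ?cat_rcons //; congr (_ - _).
  rewrite /linprod -cats1 big_cat big_seq1 /= mulrBr mulr1 coefB.
  rewrite -scalerAr coefZ coefMX; case: N => //=; by rewrite mulr0.
elim=> [|N IHN]; first by rewrite !sdivs0; have := H 0%N; rewrite !sdivs0 subr0.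
have E w : sdivs (x :: s) w N.+1 = sdivs s w N.+1 + x * sdivs (x :: s) w N by [].
by rewrite !E H IHN mulrBr opprB addrACA (addrAC (x * _)) subrr add0r.
Qed.

End PowerSeriesDivision.

Section SymmetricLeadingForms.
Variables (K : comNzRingType) (n : nat).
Local Notation P := (mpoly n K).

Lemma mnm1_lt (i j : 'I_n) : (i < j)%N -> (mnm1 j < mnm1 i)%O.
Proof.
move=> ij; apply/ltmcP; first by rewrite !mdeg1.
exists i => [k ki|]; rewrite !mnm1E ?eqxx.
  by rewrite -!val_eqE /= !gtn_eqF // (ltn_trans ki).
by rewrite -val_eqE /= gtn_eqF.
Qed.

Definition xvars (s : seq 'I_n) : seq P := [seq 'x_j | j <- s].

(** For the constant series c = 1, the quotient by the factors 1 - x_j z for j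
    in s is the generating series of the complete homogeneous symmetric
    polynomials in these variables.  Adding to c terms of degree less than N in
    each rank N > 0 does not affect the leading monomials, namely the N-th
    powers of the largest variable in s, which is the one of least index. *)
Section Lead.
Variable c : nat -> P.
Hypothesis c0 : c 0%N = 1.
Hypothesis c_deg : forall N m, (0 < N)%N -> (N <= mdeg m)%N -> mcoeff m (c N) = 0.

Lemma sdivs_below (i : 'I_n) s N : all (fun j : 'I_n => i < j)%N s ->
  (0 < N)%N -> below (mnm_muln (mnm1 i) N) (sdivs (xvars s) c N).
Proof.
elim: s N => [|j s IH] N /=.
  move=> _ N0 m /lemc_mdeg; rewrite mdegMn mdeg1 mul1n.
  exact: c_deg.
move=> /andP[ij si]; elim: N => // -[|N] IHN _ /=.
  apply: belowD; first exact: IH.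
  rewrite addr0 sdivs0 c0 mulr1 mulm1n; apply: belowX; exact: mnm1_lt.
apply: belowD; first exact: IH.
rewrite mulmS addmC mulrC; apply: below_mul (IHN isT) _ => a ia.
exact: belowX (mnm1_lt ij) _ (ltW ia).
Qed.

Lemma sdivs_monic (i : 'I_n) s N : all (fun j : 'I_n => i < j)%N s ->
  monic_at (mnm_muln (mnm1 i) N) (sdivs (xvars (i :: s)) c N).
Proof.
move=> si; elim: N => [|N IHN] /=.
  by rewrite addr0 sdivs0 c0 mulm0n; exact: monic_at1.
rewrite /monic_at -addrA; apply: belowD; first exact: sdivs_below.
by rewrite mulmS; apply: monic_atM IHN; exact: monic_atX.
Qed.

End Lead.

(** Vieta's formula for the product of the factors 1 - x_i z. *)
Lemma coef_linprod (A : comNzRingType) (x : 'I_n -> A) N :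
  (linprod [seq x i | i <- enum 'I_n])`_N =
  (-1) ^+ N * elem_sym x N.
Proof.
rewrite /linprod /elem_sym big_map enumT.
under eq_bigr => i _ do rewrite addrC.
rewrite bigA_distr coef_sum big_mkcond mulr_sumr [RHS]big_mkcond /=.
apply: eq_bigr => B _.
rewrite (bigID (fun i => i \in B)) /= [X in _ * X]big1 ?mulr1 => [|i /negPf->//].
rewrite (eq_bigr (fun i => (- x i) *: 'X)) => [|i ->]; last by rewrite scaleNr.
rewrite scaler_prod prodr_const coefZ coefXn.
rewrite prodrN; case: eqP => [->|/eqP/negPf]; last by rewrite eq_sym => ->; rewrite mulr0.
by rewrite !eqxx mulr1.
Qed.

Variables (S : subringClosed K) (r : 'I_n -> P).
Hypothesis r_deg : forall (i : 'I_n) m, (i < mdeg m)%N -> mcoeff m (r i) = 0.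
Hypothesis rS : forall i, r i \is a mpolyOver n S.

Let f (i : 'I_n) := mesym n K i.+1 + r i.

Lemma mpolyOver_mesym k : mesym n K k \is a mpolyOver n S.
Proof. by apply: rpred_sum => B _; apply: rpred_prod => i _; exact: mpolyOverX. Qed.

(** In terms of generating series, the family f is, up to signs, c minus the
    product of all the factors 1 - x_j z, where c is 1 plus terms of lower
    degree in each rank.  Division by the factors with j >= i leaves in rank i + 1 only the
    complete homogeneous polynomial in the variables x_j, j >= i, plus terms of
    lower degree: the rest of the product has degree i in z.  This gives
    generators g_i with leading monomials x_i^(i+1) of the same ideal. *)
Lemma span_over_symmetric p : p \is a mpolyOver n S ->
  span_over predT f p -> span_over S f p.
Proof.
move=> pS pf.
(* Rank 0 is 0, and rank N > 0 is f_N up to sign; f is numbered from 0. *)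
pose a N := if N is N'.+1 then
  (if insub N' is Some i then (-1) ^+ N' * f i else 0) else 0.
pose V := enum 'I_n.
pose g (i : 'I_n) := sdivs (xvars (drop i V)) a i.+1.
have dropE (i : 'I_n) : drop i V = i :: drop i.+1 V.
  by rewrite (drop_nth i) ?size_enum_ord // nth_ord_enum.
have drop_gt (i : 'I_n) : all (fun j : 'I_n => i < j)%N (drop i.+1 V).
  apply/allP => j /(map_f val); rewrite map_drop val_enum_ord drop_iota.
  by rewrite mem_iota => /andP[].
have sgn N : (-1) ^+ N \is a mpolyOver n S by rewrite rpredX // rpredN rpred1.
have gf i : span_over S f (g i).
  apply: (sdivs_closed (Q := span_over S f)) => [||_ b /mapP[j _ ->]|N].
  - exact: span_overD.
  - exact: span_over0.
  - by apply: span_overM; exact: mpolyOverX.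
  - case: N => [|N] /=; first exact: span_over0.
    case: insub => [j|]; last exact: span_over0.
    by apply: span_overM => //; exact: span_over_gen.
(* Multiplying back by the factors 1 - x_k z one at a time, the ranks N <= k
   stay in the ideal: the only new one, N = k, comes from g at k - 1. *)
have fg i : span_over S g (f i).
  have H k N : (k <= n)%N -> (N <= k)%N -> span_over S g (sdivs (xvars (drop k V)) a N).
    elim: k N => [|k IH] N kn Nk.
      move: Nk; rewrite leqn0 => /eqP->; rewrite sdivs0; exact: span_over0.
    have := sdiv_prev 'x_(Ordinal kn) (sdivs (xvars (drop k.+1 V)) a) N.
    rewrite -[sdiv _ _]/(sdivs (xvars (Ordinal kn :: drop k.+1 V)) a).
    rewrite -(dropE (Ordinal kn)) => ->; apply: span_overD; last first.
      apply: span_overN; case: N Nk => [|N] Nk; first exact: span_over0.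
      apply: span_overM; first exact: mpolyOverX.
      by apply: IH => //; exact: ltnW.
    move: Nk; rewrite leq_eqVlt => /orP[/eqP->|Nk].
      exact: (span_over_gen _ g (Ordinal kn)).
    by apply: IH => //; exact: ltnW.
  have := H n i.+1 (leqnn n) (ltn_ord i).
  rewrite drop_oversize ?size_enum_ord // /= valK.
  move=> /(span_overM (sgn i)); rewrite mulrA -exprD addnn -mul2n exprM sqrrN.
  by rewrite !expr1n mul1r.
have gS i : g i \is a mpolyOver n S.
  apply: (sdivs_closed (Q := fun b => b \is a mpolyOver n S)) => [b b'|||N].
  - exact: rpredD.
  - exact: rpred0.
  - by move=> _ b /mapP[j _ ->]; apply: rpredM; exact: mpolyOverX.
  - case: N => [|N] /=; first exact: rpred0.
    by case: insub => [j|]; rewrite ?rpred0 // rpredM // rpredD // mpolyOver_mesym.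
have gM i : monic_at (mnm_muln (mnm1 i) i.+1) (g i).
  pose c N := a N + (linprod (xvars V))`_N.
  have := @sdivs_linprod _ (xvars (take i V)) (xvars (drop i V)) a c.
  rewrite -map_cat cat_take_drop => /(_ (fun N => esym (addrK _ _))) => /(_ i.+1).
  rewrite [X in _ - X]nth_default ?subr0; last first.
    apply: leq_trans (size_linprod _) _.
    by rewrite size_map ltnS size_take geq_minl.
  rewrite -/(g i) => ->; rewrite dropE.
  have c0 : c 0%N = 1.
    by rewrite /c /= add0r coef_linprod expr0 mul1r -[RHS](mesym0E n K).
  suff c_deg : forall N m, (0 < N)%N -> (N <= mdeg m)%N -> mcoeff m (c N) = 0.
    exact: (@sdivs_monic c c0 c_deg i _ i.+1 (drop_gt i)).
  case=> // N m _ Nm; rewrite /c coef_linprod -[elem_sym _ _]/(mesym n K N.+1) /=.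
  case: insubP => [j _ jN|]; last first.
    by rewrite -leqNgt => nN; rewrite mesym_geqnE // mulr0 addr0 mcoeff0.
  rewrite /f jN exprS mulN1r mulNr -mulrBr addrAC subrr add0r.
  by rewrite -signr_odd mulr_sign; case: ifP => _; rewrite ?mcoeffN r_deg ?oppr0 // jN.
have [q pE] : exists q : 'I_n -> P, p = \sum_i q i * g i.
  have [|q _ pE] := span_over_trans (S := predT) (g := g) _ pf; last by exists q.
  move=> i; have [q _ fE] := fg i; exists q => // j; exact/mpolyOverP.
apply: span_over_trans gf _.
exact: (span_over_triangular (e := fun i : 'I_n => i.+1) _ gM gS pS pE).
Qed.

End SymmetricLeadingForms.

(** * The Wronskian as a signed sum of squarefree monomials *)

Section SquarefreeSums.
Variables (A : comNzRingType) (I : finType).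
Implicit Types (x : I -> A) (B J : {set I}) (k : nat).

(** Distributing the product, J is the set of the factors that contribute x_i;
    a factor i outside B is written as 0 + 1. *)
Lemma coef_prodXD B x k : (k <= #|B|)%N ->
  (\prod_(i in B) ('X + (x i)%:P))`_(#|B| - k) =
  \sum_(J : {set I} | (#|J| == k) && (J \subset B)) \prod_(i in J) x i.
Proof.
move=> kB; rewrite big_mkcond /=.
rewrite (eq_bigr (fun i => (if i \in B then (x i)%:P else 0) +
    (if i \in B then 'X else 1))) => [|i _]; last first.
  by case: ifP; rewrite ?add0r // addrC.
rewrite bigA_distr coef_sum [RHS]big_mkcond /=; apply: eq_bigr => J _.
have [JB|/subsetPn[i iJ iB]] := boolP (J \subset B); last first.
  by rewrite (bigD1 i) //= iJ (negPf iB) mul0r coef0 andbF.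
rewrite (bigID (fun i => i \in J)) /=.
rewrite (eq_bigr (fun i => (x i)%:P)) => [|i iJ]; last by rewrite iJ (fintype.subsetP JB).
rewrite -rmorph_prod coefCM.
rewrite (eq_bigr (fun i => if i \in B then 'X else 1)) => [|i /negPf-> //].
rewrite -big_mkcondr /= prodr_const coefXn.
have -> : #|[pred i | (i \notin J) && (i \in B)]| = (#|B| - #|J|)%N.
  by rewrite -(cardsDS JB); apply: eq_card => i; rewrite !inE.
rewrite andbT; have := subset_leq_card JB; set a := #|J|; set b := #|B| => ab.
have -> : (b - k == b - a)%N = (a == k).
  by rewrite -(eqn_add2r (k + a)) addnA subnK // (addnC k) addnA subnK // eqn_add2l eq_sym.
by case: eqP; rewrite ?mulr1 ?mulr0.
Qed.

(** The form taken by the coefficients of the Wronskian, with s marking the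
    variables of the first polynomial. *)
Definition wron_sym (s : pred I) x k : A :=
  \sum_j (-1) ^+ (s j) *
    \sum_(J : {set I} | (#|J| == k) && (j \notin J)) \prod_(i in J) x i.

End SquarefreeSums.

Lemma rmorph_elem_sym (A B : comNzRingType) (I : finType) (h : {rmorphism A -> B})
  (x : I -> A) k : h (elem_sym x k) = elem_sym (h \o x) k.
Proof. by rewrite rmorph_sum; apply: eq_bigr => J _; rewrite rmorph_prod. Qed.

Lemma rmorph_wron_sym (A B : comNzRingType) (I : finType) (h : {rmorphism A -> B})
  s (x : I -> A) k : h (wron_sym s x k) = wron_sym s (h \o x) k.
Proof.
rewrite rmorph_sum; apply: eq_bigr => j _; rewrite rmorphM rmorph_sign rmorph_sum.
by congr (_ * _); apply: eq_bigr => J _; rewrite rmorph_prod.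
Qed.

Lemma deriv_prod_ord (A : comNzRingType) n (F : 'I_n -> {poly A}) :
  (\prod_(i < n) F i)^`() = \sum_j (F j)^`() * \prod_(i < n | i != j) F i.
Proof.
elim: n F => [|n IH] F; first by rewrite !big_ord0 derivC.
rewrite big_ord_recl derivM IH big_ord_recl; congr (_ * _ + _).
  by rewrite [RHS]big_mkcond big_ord_recl /= mul1r.
rewrite mulr_sumr; apply: eq_bigr => j _.
rewrite mulrCA; congr (_ * _).
by rewrite [RHS]big_mkcond big_ord_recl /= [in LHS]big_mkcond.
Qed.

(** Differentiating a product of linear factors amounts to removing one of
    them; the sign tells from which of p and q it was removed. *)
Lemma wronskian_prodXD (A : comNzRingType) m n (x : 'I_(m + n) -> A) :
  let p := \prod_(i < m) ('X + (x (lshift n i))%:P) in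
  let q := \prod_(j < n) ('X + (x (rshift m j))%:P) in
  p * q^`() - q * p^`() =
  \sum_(j < m + n) (-1) ^+ (j < m)%N * \prod_(i in [set~ j]) ('X + (x i)%:P).
Proof.
move=> p q; have D c : ('X + (c : A)%:P)^`() = 1 by rewrite derivD derivX derivC addr0.
rewrite big_split_ord addrC /=; congr (_ + _).
  rewrite /p deriv_prod_ord mulr_sumr -sumrN; apply: eq_bigr => j _.
  rewrite ltn_ord expr1 mulN1r D mul1r; congr (- _).
  rewrite big_split_ord /= mulrC; congr (_ * _).
    by apply: eq_bigl => i; rewrite !inE (inj_eq (@lshift_inj _ _)).
  by apply: eq_bigl => i; rewrite !inE eq_rlshift.
rewrite /q deriv_prod_ord mulr_sumr; apply: eq_bigr => j _.
rewrite ltnNge leq_addr expr0 mul1r D mul1r big_split_ord /=; congr (_ * _).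
  by apply: eq_bigl => i; rewrite !inE eq_lrshift.
by apply: eq_bigl => i; rewrite !inE (inj_eq (@rshift_inj _ _)).
Qed.

Lemma coef_wronskian (A : comNzRingType) m n (x : 'I_(m + n) -> A) k :
  let p := \prod_(i < m) ('X + (x (lshift n i))%:P) in
  let q := \prod_(j < n) ('X + (x (rshift m j))%:P) in
  (k < m + n)%N ->
  (p * q^`() - q * p^`())`_(m + n - k.+1) = wron_sym (fun j : 'I_(m + n) => j < m)%N x k.
Proof.
move=> p q kmn; rewrite wronskian_prodXD coef_sum; apply: eq_bigr => j _.
have sE (b : bool) (r : {poly A}) l : ((-1) ^+ b * r)`_l = (-1) ^+ b * r`_l.
  by case: b; rewrite ?mul1r // !mulN1r coefN.
have cj : #|[set~ j]| = (m + n).-1 by rewrite cardsC1 card_ord.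
rewrite sE -[k.+1]add1n subnDA subn1 -cj.
rewrite coef_prodXD; last by rewrite cj -ltnS prednK // (leq_ltn_trans _ kmn).
congr (_ * _); apply: eq_bigl => J; congr (_ && _).
by rewrite finset.subsetC finset.sub1set inE.
Qed.

Section Polys.
Variables (K : comNzRingType) (n : nat).

Lemma prod_mesym1 (J : {set 'I_n}) :
  \prod_(i in J) 'x_i = mpolyX K (mesym1 J).
Proof.
rewrite mprodXE; congr (mpolyX K _); apply/mnmP => i.
rewrite mnmE mnm_sumE big_mkcond /=.
rewrite (bigD1 i) //= mnmE eqxx /= big1 ?addn0 => [|j ji].
  by case: (i \in J).
by case: (_ \in _); rewrite // mnmE (negbTE ji).
Qed.

Lemma mcoeff_wron_sym_eq0 s k (m : multinom n) :
  (forall J : {set 'I_n}, #|J| = k -> mesym1 J <> m) ->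
  mcoeff m (wron_sym s (fun i => 'x_i) k : mpoly n K) = 0.
Proof.
move=> Jm; rewrite raddf_sum big1 //= => j _.
have sE (b : bool) (r : mpoly n K) : mcoeff m ((-1) ^+ b * r) = (-1) ^+ b * mcoeff m r.
  by case: b; rewrite ?mul1r // !mulN1r mcoeffN.
rewrite sE raddf_sum big1 ?mulr0 //= => J /andP[/eqP Jk _].
by rewrite prod_mesym1 mcoeffX; case: eqP => // /(Jm _ Jk).
Qed.

Lemma mpolyOver_wron_sym (S : subringClosed K) s k :
  (wron_sym s (fun i => 'x_i) k : mpoly n K) \is a mpolyOver n S.
Proof.
apply: rpred_sum => j _; apply: rpredM; first by rewrite rpredX // rpredN rpred1.
by apply: rpred_sum => B _; apply: rpred_prod => i _; exact: mpolyOverX.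
Qed.

End Polys.

(** * Integral Puiseux series; Laurent polynomials and polynomials *)

Section PuiseuxIntegers.
Variable R : realType.
Local Notation C := (R[i]).
Local Notation L := (cpuiseux R).
Implicit Types (x y : L) (q r : rat) (c : C).

Lemma pcoefD x y q : (x + y) q = x q + y q.
Proof. by []. Qed.

Lemma pcoefN x q : (- x) q = - x q.
Proof. by []. Qed.

Lemma pcoef0 q : (0 : L) q = 0.
Proof. by rewrite /= /single; case: eqP. Qed.

Lemma pcoef_sum (I : Type) (s : seq I) (F : I -> L) q :
  (\sum_(i <- s) F i) q = \sum_(i <- s) F i q.
Proof. exact: (big_morph (fun x : L => x q) (fun x y => pcoefD x y q) (pcoef0 q)). Qed.

Lemma pcoefM_eq0 x y q : (forall p, x p = 0 \/ y (q - p) = 0) -> (x * y) q = 0.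
Proof.
move=> H; rewrite /= /conv fsbig1 // => p _.
by case: (H p) => ->; rewrite ?mul0r ?mulr0.
Qed.

Lemma pcoef_psingleM c r x q : (psingle c r * x) q = c * x (q - r).
Proof.
rewrite /= /conv (fsbigE [:: r]) //; last first.
  by move=> p _; rewrite inE /single => /negPf->; rewrite mul0r.
by rewrite big_mkcond big_seq1 in_setT /= /single eqxx.
Qed.

(** The valuation ring of L and its maximal ideal; the residue of x is x 0. *)
Definition pint : {pred L} := [pred x : L | `[< forall q, q < 0 -> x q = 0 >]].

Definition psmall x := forall q, q <= 0 -> x q = 0.

Lemma pintP x : reflect (forall q, q < 0 -> x q = 0) (x \in pint).
Proof. exact: asboolP. Qed.

Fact pint_subring_closed : subring_closed pint.
Proof.
split=> [|x y /pintP xI /pintP yI|x y /pintP xI /pintP yI]; apply/pintP => q q0.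
- by rewrite /= /single lt_eqF.
- by rewrite pcoefD pcoefN xI // yI // subr0.
- apply: pcoefM_eq0 => p; have [p0|p0] := ltP p 0; first by left; exact: xI.
  by right; apply: yI; rewrite subr_lt0 (lt_le_trans q0).
Qed.

HB.instance Definition _ := GRing.isSubringClosed.Build L pint pint_subring_closed.

Lemma psmall_sum (I : Type) (s : seq I) (F : I -> L) :
  (forall i, psmall (F i)) -> psmall (\sum_(i <- s) F i).
Proof. by move=> H q q0; rewrite pcoef_sum big1 // => i _; exact: H. Qed.

Lemma psmallM x y : x \in pint -> psmall y -> psmall (x * y).
Proof.
move=> /pintP xI ys q q0; apply: pcoefM_eq0 => p.
have [p0|p0] := ltP p 0; first by left; exact: xI.
by right; apply: ys; rewrite subr_le0 (le_trans q0).
Qed.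

Lemma psmall_int x : psmall x -> x \in pint.
Proof. by move=> xs; apply/pintP => q /ltW; exact: xs. Qed.

Lemma psmall_ppow1 : psmall (ppow R 1).
Proof. by move=> q q0; rewrite /= /single lt_eqF // (le_lt_trans q0). Qed.

Lemma pconst_int c : pconst c \in pint.
Proof. by apply/pintP => q q0; rewrite /= /single lt_eqF. Qed.

Fact pconst_additive : zmod_morphism (@pconst R).
Proof.
move=> a b; apply: cpuiseux_eq => q; rewrite pcoefD pcoefN /= /single.
by case: eqP; rewrite ?subr0.
Qed.

Fact pconst_multiplicative : monoid_morphism (@pconst R).
Proof.
split=> [//|a b]; apply: cpuiseux_eq => q.
rewrite pcoef_psingleM subr0 /= /single.
by case: eqP; rewrite ?mulr0.
Qed.

HB.instance Definition _ := GRing.isZmodMorphism.Build C L (@pconst R) pconst_additive.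
HB.instance Definition _ := GRing.isMonoidMorphism.Build C L (@pconst R) pconst_multiplicative.

(** So the residue of a sum with complex scalars can be computed without
    assuming that the other factors are integral. *)
Lemma pcoefMC x c q : (x * pconst c) q = x q * c.
Proof. by rewrite mulrC pcoef_psingleM subr0 mulrC. Qed.

Lemma pval_ge x r : x != 0 -> (forall q, q < r -> x q = 0) -> r <= pval x.
Proof.
move=> x0 xr; have [xv _] := pvalP x0; rewrite leNgt; apply/negP => /xr/eqP.
by rewrite (negPf xv).
Qed.

Lemma pval_unit x : x \in pint -> x 0 != 0 -> x != 0 /\ pval x = 0.
Proof.
move=> /pintP xI x00; have x0 : x != 0.
  by apply: contraNneq x00 => ->; rewrite pcoef0.
split=> //; apply: le_anti; rewrite pval_ge // andbT.
by have [_ ->] := pvalP x0.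
Qed.

Lemma pval1 : pval (1 : L) = 0.
Proof.
by have [||] // := @pval_unit 1; rewrite ?rpred1 // /= /single eqxx oner_neq0.
Qed.

Lemma pval_ppow1M x : x \in pint -> ppow R 1 * x != 0 -> 1 <= pval (ppow R 1 * x).
Proof.
move=> /pintP xI tx0; apply: pval_ge => // q q1.
by rewrite pcoef_psingleM xI ?mulr0 // subr_lt0.
Qed.

End PuiseuxIntegers.

Section LaurentPolynomials.
Variables (K : comNzRingType) (n : nat).
Local Notation LP := (laurent K n).
Implicit Types (f g : LP) (u v w : 'rV[int]_n).

Lemma lcoefD f g u : (f + g) u = f u + g u.
Proof. exact: laddE. Qed.

Lemma lcoef0 u : (0 : LP) u = 0.
Proof. by rewrite lmonomE if_same. Qed.

Lemma lcoef_sum (I : Type) (s : seq I) (F : I -> LP) u :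
  (\sum_(i <- s) F i) u = \sum_(i <- s) F i u.
Proof. exact: (big_morph (fun f : LP => f u) (fun f g => lcoefD f g u) (lcoef0 u)). Qed.

Lemma lcoef_monomM (c : K) u f w : (lmonom c u * f) w = c * f (w - u).
Proof.
rewrite [LHS]lmulE (@fsbigTE _ _ _ _ [fset u]%fset) => [|v].
  by rewrite big_seq_fset1 lmonomE eqxx.
by rewrite inE lmonomE => /negPf->; rewrite mul0r.
Qed.

Lemma lmonomM (a b : K) u v : lmonom a u * lmonom b v = lmonom (a * b) (u + v).
Proof.
apply: laurent_eq => w; rewrite lcoef_monomM !lmonomE subr_eq.
by rewrite [v + u]addrC; case: eqP; rewrite ?mulr0.
Qed.

Fact lconst_additive : zmod_morphism (@lconst K n).
Proof.
move=> a b; apply: laurent_eq => u; rewrite lcoefD [in RHS]loppE !lmonomE.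
by case: eqP; rewrite ?subr0.
Qed.

Fact lconst_multiplicative : monoid_morphism (@lconst K n).
Proof. by split=> [//|a b]; rewrite lmonomM addr0. Qed.

HB.instance Definition _ := GRing.isZmodMorphism.Build K LP (@lconst K n) lconst_additive.
HB.instance Definition _ := GRing.isMonoidMorphism.Build K LP (@lconst K n) lconst_multiplicative.

Definition laurent_of_mpoly : mpoly n K -> LP := mmap (@lconst K n) (@lvar K n).

HB.instance Definition _ := GRing.RMorphism.copy laurent_of_mpoly laurent_of_mpoly.

Definition vec (m : multinom n) : 'rV[int]_n := \row_i (m i)%:Z.

Lemma vec_inj : injective vec.
Proof.
move=> a b ab; apply/mnmP => i.
by have /rowP/(_ i) := ab; rewrite !mxE => -[].
Qed.

Lemma mmap1_lvar m : mmap1 (@lvar K n) m = lmonom 1 (vec m).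
Proof.
have X (i : 'I_n) k : lvar K i ^+ k = lmonom 1 (k%:Z *: delta_mx 0 i).
  elim: k => [|k IH]; first by rewrite scale0r.
  by rewrite exprS IH lmonomM mulr1 intS scalerDl scale1r.
rewrite /mmap1; under eq_bigr => i _ do rewrite X.
have -> : vec m = \sum_i ((m i)%:Z *: delta_mx 0 i).
  by rewrite [LHS]row_sum_delta; apply: eq_bigr => i _; rewrite mxE.
symmetry; apply: (big_morph (fun u => lmonom (1 : K) u)) => // u v.
by rewrite lmonomM mulr1.
Qed.

Lemma laurent_of_mpolyE p :
  laurent_of_mpoly p = \sum_(m <- msupp p) lmonom (mcoeff m p) (vec m).
Proof.
by apply: eq_bigr => m _; rewrite mmap1_lvar lmonomM mulr1 add0r.
Qed.

Lemma laurent_of_mpolyZX c m :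
  laurent_of_mpoly (c *: mpolyX K m) = lmonom c (vec m).
Proof.
by rewrite /laurent_of_mpoly mmapZ mmapX mmap1_lvar lmonomM mulr1 add0r.
Qed.

Lemma laurent_of_mpoly_coef p m : laurent_of_mpoly p (vec m) = mcoeff m p.
Proof.
rewrite laurent_of_mpolyE lcoef_sum.
have [mp|/memN_msupp_eq0 mp] := boolP (m \in msupp p); last first.
  rewrite mp big1_seq // => a /andP[_ ap]; rewrite lmonomE.
  by case: eqP => // /vec_inj ma; move: ap; rewrite -ma mcoeff_msupp mp eqxx.
rewrite (bigD1_seq m) ?msupp_uniq //= lmonomE eqxx big1 ?addr0 // => a am.
by rewrite lmonomE; case: eqP => // /vec_inj ma; rewrite ma eqxx in am.
Qed.

Lemma laurent_of_mpoly_supp p u : laurent_of_mpoly p u != 0 -> exists m, u = vec m.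
Proof.
rewrite laurent_of_mpolyE lcoef_sum => pu; apply: contrapT => nm; move/eqP: pu; apply.
rewrite big1 // => m _; rewrite lmonomE; case: eqP => // um.
by case: nm; exists m.
Qed.

Lemma laurentE f : f = \sum_(u <- finsupp f) lmonom (f u) u.
Proof.
apply: laurent_eq => w; rewrite lcoef_sum.
have [wf|wf] := boolP (w \in finsupp f); last first.
  rewrite fsfun_dflt // big1_seq // => u /andP[_ uf]; rewrite lmonomE.
  by case: eqP => // wu; rewrite wu uf in wf.
rewrite (bigD1_seq w) ?fset_uniq //= lmonomE eqxx big1 ?addr0 // => u uw.
by rewrite lmonomE eq_sym (negPf uw).
Qed.

(** The bound on N is uniform upwards so that one monomial can serve for
    finitely many Laurent polynomials. *)
Lemma laurent_clear f : exists N0, forall N, (N0 <= N)%N ->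
  exists p, lmonom 1 (const_mx N%:Z) * f = laurent_of_mpoly p.
Proof.
rewrite (laurentE f); apply: (big_ind (fun f : LP => exists N0, forall N, (N0 <= N)%N ->
  exists p, lmonom 1 (const_mx N%:Z) * f = laurent_of_mpoly p)).
- by exists 0%N => N _; exists 0; rewrite mulr0 rmorph0.
- move=> g h [a Ha] [b Hb]; exists (maxn a b) => N; rewrite geq_max => /andP[aN bN].
  have [p pE] := Ha _ aN; have [q qE] := Hb _ bN.
  by exists (p + q); rewrite mulrDr pE qE rmorphD.
move=> u _; exists (\sum_(i < n) `|u 0%R i|)%N => N uN.
exists (f u *: mpolyX K (Multinom [tuple `|(u 0 i + N%:Z)%R|%N | i < n])).
rewrite laurent_of_mpolyZX lmonomM mul1r; congr lmonom.
apply/rowP => i; rewrite !mxE multinomE tnth_mktuple addrC gez0_abs //.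
have : (`|u 0%R i| <= N)%N by apply: leq_trans uN; rewrite (bigD1 i) //= leq_addr.
rewrite -lez_nat abszE => uN'.
rewrite -[X in 0 <= X]opprK oppr_ge0 opprD subr_le0.
by apply: le_trans uN'; rewrite -normrN ler_norm.
Qed.

End LaurentPolynomials.

Local Open Scope classical_set_scope.
Local Open Scope ring_scope.

(** * Tropical hypersurfaces; the coefficients of the system *)

Lemma bigmin_attained (R : realType) (T : eqType) (F : T -> R) (s : seq T) :
  s != [::] -> exists u, [/\ u \in s,
    (F u)%:E = \big[Order.min/+oo%E]_(v <- s) (F v)%:E &
    forall v, v \in s -> F u <= F v].
Proof.
elim: s => //= a s IH _; rewrite big_cons.
have [->|/IH[u [us <- um]]] := eqVneq s [::].
  exists a; split; rewrite ?mem_head //.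
    by rewrite big_nil minEle leey.
  by move=> v; rewrite mem_seq1 => /eqP->.
rewrite -EFin_min; have [au|ua] := leP (F a) (F u).
  exists a; split=> //; first exact: mem_head.
  by move=> v; rewrite in_cons => /orP[/eqP->//|/um]; exact: le_trans.
exists u; split=> //; first by rewrite in_cons us orbT.
by move=> v; rewrite in_cons => /orP[/eqP->|/um//]; exact: ltW.
Qed.

Section TropicalMinimum.
Variables (R : realType) (n : nat).
Local Notation LP := (laurent (cpuiseux R) n).
Implicit Types (f : LP) (w : 'rV[R]_n) (u v : 'rV[int]_n).

Lemma trop_attained f w : f != 0 -> exists u, [/\ u \in finsupp f,
  (trop_term f w u)%:E = trop f w &
  forall v, v \in finsupp f -> trop_term f w u <= trop_term f w v].
Proof.
move=> f0; apply: bigmin_attained.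
apply: contraNneq f0 => s0; apply/eqP/laurent_eq => u.
by rewrite lcoef0 fsfun_dflt // -[_ \in _]/(u \in enum_fset (finsupp f)) s0.
Qed.

(** The minimum is attained at least twice when no term is strictly smaller
    than all the others. *)
Lemma trop_hypersurfaceP f w : f != 0 -> trop_hypersurface f w <->
  forall u, u \in finsupp f -> exists v, [/\ v \in finsupp f, v != u &
    trop_term f w v <= trop_term f w u].
Proof.
move=> f0; have [a [af aE amin]] := trop_attained w f0; split.
  case=> [/eqP|[u [v [uv uf vf uE vE]]] b bf]; first by rewrite (negPf f0).
  have [ub|ub] := eqVneq u b; [exists v|exists u]; split=> //.
  - by rewrite -ub eq_sym.
  - by rewrite -lee_fin vE -aE lee_fin; exact: amin.
  - by rewrite -lee_fin uE -aE lee_fin; exact: amin.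
move=> /(_ a af)[v [vf va vle]]; right; exists a, v; split=> //.
  by rewrite eq_sym.
by rewrite -aE; congr EFin; apply: le_anti; rewrite vle amin.
Qed.

End TropicalMinimum.

Section BetheCoefficients.
Variables (R : realType) (m n : nat) (d : nat -> R[i]).
Local Notation L := (cpuiseux R).
Local Notation M := (m + n)%N.
Implicit Types (B : {set 'I_M}) (i : 'I_M).

Let isx : pred 'I_M := fun j => (j < m)%N.

(** The part of f_(i+1) of degree at most i, the leading form being e_(i+1);
    the index i starts from 0. *)
Definition bethe_correction i : mpoly M L :=
  ppow R 1 *: wron_sym isx (fun j => 'x_j) i - mpolyC M (pconst (d i.+1)).

Definition bethe_mpoly i : mpoly M L := mesym M L i.+1 + bethe_correction i.

Lemma bethe_polyE i :
  bethe_poly m n d i.+1 = laurent_of_mpoly (bethe_mpoly i).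
Proof.
have X : @laurent_of_mpoly L M \o (fun j : 'I_M => 'x_j) =1 @lvar L M.
  by move=> j; rewrite /= /laurent_of_mpoly mmapX mmap1U.
have X' : @laurent_of_mpoly L M \o (fun j : 'I_M => 'x_j) = @lvar L M by apply/funext.
rewrite /bethe_poly /bethe_mpoly /bethe_correction addrA raddfB raddfD /=.
rewrite -mul_mpolyC rmorphM /=.
rewrite [laurent_of_mpoly (mpolyC _ (pconst _))]mmapC.
rewrite [laurent_of_mpoly (mpolyC _ (ppow _ _))]mmapC.
rewrite rmorph_wron_sym X' /wr_coef coef_wronskian //.
rewrite -[mesym _ _ _]/(elem_sym (fun j : 'I_M => 'x_j) i.+1) rmorph_elem_sym X'.
by [].
Qed.

Lemma bethe_coef_mesym1 i B : mcoeff (mesym1 B) (bethe_mpoly i) =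
  (#|B| == i.+1)%:R + (ppow R 1 * mcoeff (mesym1 B) (wron_sym isx (fun j => 'x_j) i)
    - (if B == finset.set0 then pconst (d i.+1) else 0)).
Proof.
rewrite /bethe_mpoly mcoeffD mcoeff_mesym mcoeffB mcoeffZ mcoeffC.
congr (_%:R + (_ - _)).
  rewrite /mechar mdeg_mesym1 andb_idr // => _; apply/forallP => j.
  by rewrite mnmE leq_b1.
rewrite -mdeg_eq0 mdeg_mesym1 cards_eq0.
by case: eqP; rewrite ?mulr1 ?mulr0.
Qed.

Lemma bethe_coef_out i a : (forall B, a <> mesym1 B) -> mcoeff a (bethe_mpoly i) = 0.
Proof.
move=> aB; rewrite /bethe_mpoly mesymE mcoeffD mcoeffB mcoeffZ mcoeffC.
rewrite raddf_sum big1 => [|B _] /=; last first.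
  by rewrite mcoeffX; case: eqP => // /esym/aB.
have /negPf-> : a != mnm0.
  by apply/eqP => a0; apply: (aB finset.set0); rewrite a0 mesym1_set0.
by rewrite mcoeff_wron_sym_eq0 ?mulr0 ?subr0 ?addr0 // => J _ /esym/aB.
Qed.

End BetheCoefficients.

(** * The tropical prevariety is the origin *)

Section SubsetSums.
Variables (R : realDomainType) (I : finType) (w : I -> R).
Implicit Types (B : {set I}).

Let neg : {set I} := [set j | w j < 0]%SET.

(** Removing nonnegative terms or adding negative ones lowers a sum. *)
Lemma sum_neg_le B : \sum_(j in neg) w j <= \sum_(j in B) w j.
Proof.
rewrite [leRHS](big_setID neg) [leLHS](big_setID B) finset.setIC lerD2l.
apply: (@le_trans _ _ 0).
  by apply: sumr_le0 => j; rewrite !inE => /andP[_ /ltW].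
by apply: sumr_ge0 => j; rewrite !inE -leNgt => /andP[].
Qed.

(** A set of the same size as neg and distinct from it misses one of its
    elements. *)
Lemma sum_neg_lt B : #|B| = #|neg| -> B != neg ->
  \sum_(j in neg) w j < \sum_(j in B) w j.
Proof.
move=> cB nB; rewrite [ltRHS](big_setID neg) [ltLHS](big_setID B) finset.setIC ltrD2l.
have [j jneg jB] : exists2 j, j \in neg & j \notin B.
  apply/subsetPn; apply: contra nB => nsB.
  by rewrite eq_sym eqEcard nsB cB leqnn.
apply: (@lt_le_trans _ _ 0); last first.
  by apply: sumr_ge0 => k; rewrite !inE -leNgt => /andP[].
rewrite (bigD1 j) ?inE ?jB //=; last by move: jneg; rewrite inE.
rewrite ltr_wnDr //; last by move: jneg; rewrite inE.
by apply: sumr_le0 => k; rewrite !inE => /andP[/andP[_ /ltW]].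
Qed.

End SubsetSums.

Section PrevarietyIsOrigin.
Variables (R : realType) (m n : nat) (d : nat -> R[i]).
Local Notation L := (cpuiseux R).
Local Notation M := (m + n)%N.
Implicit Types (B : {set 'I_M}) (i : 'I_M) (w : 'rV[R]_M).

Local Notation ind B := (vec (mesym1 B)).
Local Notation f i := (bethe_poly m n d i.+1).

Lemma trop_term_ind i w B : trop_term (f i) w (ind B) =
  ratr (pval (f i (ind B))) + \sum_(j in B) w 0 j.
Proof.
congr (_ + _); rewrite [RHS]big_mkcond; apply: eq_bigr => j _.
by rewrite mxE mnmE; case: ifP; rewrite ?mul1r ?mul0r.
Qed.

Lemma bethe_supp i u : u \in finsupp (f i) -> exists B, u = ind B.
Proof.
rewrite mem_finsupp bethe_polyE => fu; have [a ua] := laurent_of_mpoly_supp fu.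
rewrite ua laurent_of_mpoly_coef in fu *.
apply: contrapT => nB; move/eqP: fu; apply; apply: bethe_coef_out => B aB.
by apply: nB; exists B; rewrite aB.
Qed.

Lemma bethe_ind_card i B : #|B| = i.+1 -> f i (ind B) = 1.
Proof.
move=> cB; rewrite bethe_polyE laurent_of_mpoly_coef bethe_coef_mesym1 cB eqxx.
rewrite mcoeff_wron_sym_eq0 => [|J cJ /(congr1 (@mdeg _))]; last first.
  by rewrite !mdeg_mesym1 cB cJ => /eqP; rewrite ltn_eqF.
have /negPf-> : B != finset.set0 by rewrite -cards_eq0 cB.
by rewrite mulr0 subrr addr0.
Qed.

Let wron_sym_int s i (a : multinom M) :
  mcoeff a (wron_sym s (fun j => 'x_j) i : mpoly M L) \in @pint R.
Proof. exact: (mpolyOverP _ (mpolyOver_wron_sym _ s i)). Qed.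

Lemma pval_bethe_ind i B : #|B| <> i.+1 -> B != finset.set0 ->
  f i (ind B) != 0 -> 1 <= pval (f i (ind B)).
Proof.
move=> /eqP/negPf cB /negPf B0.
rewrite bethe_polyE laurent_of_mpoly_coef bethe_coef_mesym1 cB B0 add0r subr0.
exact: pval_ppow1M.
Qed.

(** In degree 1 the Wronskian also contributes to the constant term, but with
    a factor t that the residue does not see. *)
Lemma bethe_cst i :
  f i (ind finset.set0) \in @pint R /\ f i (ind finset.set0) 0 = - d i.+1.
Proof.
rewrite bethe_polyE laurent_of_mpoly_coef bethe_coef_mesym1 cards0 eqxx add0r.
have tS := psmallM (wron_sym_int (fun j : 'I_M => (j < m)%N) i
  (mesym1 finset.set0)) (@psmall_ppow1 R).
rewrite mulrC in tS; split.
  by rewrite rpredB ?pconst_int // psmall_int.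
by rewrite pcoefD pcoefN tS // add0r /= /single eqxx.
Qed.

Lemma pval_cst_ge0 i : f i (ind finset.set0) != 0 -> 0 <= pval (f i (ind finset.set0)).
Proof. by have [/pintP f0 _] := bethe_cst i => h; apply: pval_ge. Qed.

Lemma trop_prevariety_origin w : d M != 0 ->
  (forall i, trop_hypersurface (f i) w) -> w = 0.
Proof.
move=> dM hw; pose ww j := w 0 j.
pose neg := [set j | ww j < 0]%SET.
have strict i B : ind B \in finsupp (f i) ->
    ~ (forall B', B' != B -> ind B' \in finsupp (f i) ->
        trop_term (f i) w (ind B) < trop_term (f i) w (ind B')).
  move=> fB lt; have f0 : f i != 0.
    by apply: contraTneq fB => ->; rewrite mem_finsupp lcoef0 eqxx.
  have [v [vf vB vle]] := (trop_hypersurfaceP w f0).1 (hw i) _ fB.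
  have [B' vB'] := bethe_supp vf; rewrite vB' in vf vB vle.
  have /lt/(_ vf) : B' != B by apply: contraNneq vB => ->.
  by rewrite ltNge vle.
(* With r negative coordinates, f_r would attain its minimum only at their
   product. *)
have neg0 : neg = finset.set0.
  apply/eqP/negPn/negP => neg0.
  have c0 : (0 < #|neg|)%N by rewrite card_gt0.
  have cM : (#|neg|.-1 < M)%N.
    by rewrite prednK // (leq_trans (max_card _)) // card_ord.
  pose i := Ordinal cM; have ci : #|neg| = i.+1 by rewrite /= prednK.
  have fneg := bethe_ind_card ci.
  apply: (strict i neg); first by rewrite mem_finsupp fneg oner_neq0.
  move=> B Bneg fB; rewrite !trop_term_ind fneg pval1 rmorph0 add0r.
  have [cB|cB] := eqVneq #|B| i.+1.
    rewrite bethe_ind_card // pval1 rmorph0 add0r; apply: sum_neg_lt Bneg.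
    by rewrite cB -ci.
  have [B0|B0] := eqVneq B finset.set0.
    rewrite B0 big_set0 addr0; rewrite B0 mem_finsupp in fB.
    apply: (@lt_le_trans _ _ 0); last by rewrite ler0q pval_cst_ge0.
    have /card_gt0P[j jneg] := c0; have wj : w 0 j < 0 by move: jneg; rewrite inE.
    rewrite (bigD1 j) //= ltr_wnDr // sumr_le0 // => k; rewrite inE.
    by move=> /andP[/ltW].
  rewrite mem_finsupp in fB.
  rewrite ltr_pwDl ?sum_neg_le // ltr0q (lt_le_trans ltr01) // pval_bethe_ind //.
  exact/eqP.
have w0 j : 0 <= w 0 j.
  by move/setP/(_ j): neg0; rewrite !inE /ww => /negbT; rewrite -leNgt.
(* A positive coordinate would make the constant term of f_M the only minimum:
   the only other term of valuation 0 is the product of all the variables. *)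
apply/rowP => j; rewrite mxE; apply/eqP; rewrite eq_le w0 andbT leNgt; apply/negP => wj.
have M0 : (0 < M)%N by case: (M) j {wj} => // -[].
have cM : (M.-1 < M)%N by rewrite prednK.
pose i := Ordinal cM; have iM : i.+1 = M by rewrite /= prednK.
have [cI c0] := bethe_cst i.
have [cn0 pv0] : f i (ind finset.set0) != 0 /\ pval (f i (ind finset.set0)) = 0.
  by apply: pval_unit; rewrite // c0 iM oppr_eq0.
apply: (strict i finset.set0); first by rewrite mem_finsupp.
move=> B B0 fB; rewrite !trop_term_ind pv0 rmorph0 big_set0 addr0.
have [cB|cB] := eqVneq #|B| i.+1.
  have BT : B = [set: 'I_M]%SET.
    by apply/eqP; rewrite eqEcard finset.subsetT cardsT card_ord cB iM leqnn.
  rewrite (bethe_ind_card cB) pval1 rmorph0 add0r.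
  by rewrite (bigD1 j) ?BT ?finset.in_setT //= ltr_pwDl // sumr_ge0.
rewrite mem_finsupp in fB.
rewrite ltr_pwDl ?sumr_ge0 // ltr0q (lt_le_trans ltr01) // pval_bethe_ind //.
exact/eqP.
Qed.

End PrevarietyIsOrigin.

(** * The origin lies in the tropical variety *)

Section OriginInVariety.
Variables (R : realType) (m n : nat) (d : nat -> R[i]).
Local Notation L := (cpuiseux R).
Local Notation M := (m + n)%N.
Implicit Types (i : 'I_M).

(** The opposites of the roots of the monic polynomial with coefficients c. *)
Lemma exists_elem_sym_roots (N : nat) (c : nat -> R[i]) :
  ((0 < N)%N -> c N != 0) ->
  exists2 z : 'I_N -> R[i], (forall k, (1 <= k <= N)%N -> elem_sym z k = c k) &
    forall j, z j != 0.
Proof.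
move=> cN.
pose b k : R[i] := if k == 0%N then 1 else c k.
pose p : {poly R[i]} := \poly_(j < N.+1) b (N - j)%N.
have pN : p`_N = 1 by rewrite coef_poly ltnSn subnn.
have sp : size p = N.+1.
  by rewrite size_poly_eq // subnn oner_neq0.
have pm : lead_coef p = 1 by rewrite lead_coefE sp pN.
have [r pE] := closed_field_poly_normal p; rewrite pm scale1r in pE.
have sr : size r = N.
  by move: sp; rewrite pE size_prod_XsubC => -[].
pose z (j : 'I_N) := - r`_j.
have pz : p = \prod_(j in [set: 'I_N]%SET) ('X + (z j)%:P).
  rewrite pE (big_nth 0) big_mkord sr; apply: eq_big => [j|j _]; first by rewrite finset.in_setT.
  by rewrite /z polyCN.
have ez k : (1 <= k <= N)%N -> elem_sym z k = c k.
  move=> /andP[k0 kN].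
  have := @coef_prodXD _ _ [set: 'I_N]%SET z k; rewrite cardsT card_ord -pz => /(_ kN).
  rewrite coef_poly ltnS leq_subr subKn // /b gtn_eqF // => ->.
  by apply: eq_bigl => J; rewrite finset.subsetT andbT.
exists z => // j; have N0 : (0 < N)%N by rewrite (leq_ltn_trans _ (ltn_ord j)).
apply: contraNneq (cN N0) => zj; rewrite -ez ?N0 ?leqnn // /elem_sym big1 // => J /eqP cJ.
have JT : J = [set: 'I_N]%SET.
  by apply/eqP; rewrite eqEcard finset.subsetT cardsT card_ord cJ leqnn.
by rewrite JT (bigD1 j) ?finset.in_setT //= zj mul0r.
Qed.

Local Notation T := (bethe_poly m n d @` [set k | (1 <= k <= M)%N]).

Lemma bethe_ideal_clear g : ideal_gen T g ->
  exists N p, span_over predT (bethe_mpoly d) p /\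
    lmonom 1 (const_mx N%:Z) * g = laurent_of_mpoly p.
Proof.
case=> s sT ->; suff [N0 H] : exists N0, forall N, (N0 <= N)%N ->
    exists p, span_over predT (bethe_mpoly d) p /\
      lmonom 1 (const_mx N%:Z) * (\sum_(p <- s) p.1 * p.2) = laurent_of_mpoly p.
  by exists N0; exact: H.
elim: s sT => [|[a b] s IH] sT.
  exists 0%N => N _; exists 0; rewrite big_nil mulr0 rmorph0; split=> //.
  exact: span_over0.
have [|N1 H1] := IH; first by move=> p ps; apply: sT; rewrite in_cons ps orbT.
have [N2 H2] := laurent_clear a.
exists (maxn N1 N2) => N; rewrite geq_max => /andP[/H1[p [pS pE]] /H2[q qE]].
have [k /= kM bk] : T b by exact: (sT (a, b) (mem_head _ _)).
have k0 : (k.-1 < M)%N by case/andP: kM => k0; rewrite prednK.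
exists (q * bethe_mpoly d (Ordinal k0) + p); split.
  apply: span_overD pS; apply: span_overM; first exact/mpolyOverP.
  exact: span_over_gen.
rewrite big_cons mulrDr mulrA /= qE pE rmorphD /= rmorphM /=; congr (_ * _ + _).
by rewrite -bethe_polyE /= prednK ?bk //; case/andP: kM.
Qed.

Lemma bethe_correction_deg i (a : multinom M) : (i < mdeg a)%N ->
  mcoeff a (bethe_correction d i) = 0.
Proof.
move=> ia; rewrite mcoeffB mcoeffZ mcoeffC mcoeff_wron_sym_eq0 => [|J cJ Ja].
  by rewrite -mdeg_eq0 gtn_eqF ?mulr0 ?subr0 // (leq_ltn_trans _ ia).
by move: ia; rewrite -Ja mdeg_mesym1 cJ ltnn.
Qed.

Lemma bethe_correction_int i : bethe_correction d i \is a mpolyOver M (@pint R).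
Proof.
rewrite rpredB ?mpolyOverZ ?mpolyOver_wron_sym ?mpolyOverC ?pconst_int //.
exact/psmall_int/psmall_ppow1.
Qed.

Lemma meval_int (zz : 'I_M -> L) (p : mpoly M L) : (forall j, zz j \in @pint R) ->
  p \is a mpolyOver M (@pint R) -> meval zz p \in @pint R.
Proof.
move=> zI pI; rewrite mevalE; apply: rpred_sum => a _; apply: rpredM.
  exact: (mpolyOverP _ pI).
by apply: rpred_prod => j _; apply: rpredX; exact: zI.
Qed.

(** At t = 0 the system reduces to e_k = d_k, which z satisfies. *)
Lemma bethe_mpoly_small (z : 'I_M -> R[i]) i : elem_sym z i.+1 = d i.+1 ->
  psmall (meval (fun j => pconst (z j)) (bethe_mpoly d i)).
Proof.
move=> ez; pose zz j : L := pconst (z j).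
have X : meval zz \o (fun j => 'x_j) = zz.
  by apply/funext => j; rewrite /= mevalXU.
rewrite /bethe_mpoly -[mesym _ _ _]/(elem_sym (fun j : 'I_M => 'x_j) i.+1).
rewrite rmorphD /= rmorph_elem_sym X -[zz]/(@pconst R \o z) -rmorph_elem_sym ez.
rewrite rmorphB /= mevalZ mevalC addrC subrK mulrC; apply: psmallM; last first.
  exact: psmall_ppow1.
by apply: meval_int => [j|]; rewrite ?pconst_int ?mpolyOver_wron_sym.
Qed.

(** If u were the only exponent of least valuation in g, then the value at z of
    P, the polynomial obtained by clearing denominators and normalizing the
    valuation, would have a nonzero residue by its expansion into monomials,
    and residue 0 by its expression in terms of the f_k. *)
Lemma origin_in_trop_variety : ((0 < M)%N -> d M != 0) ->
  trop_variety (ideal_gen T) 0.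
Proof.
move=> dM g gI; have [g0|g0] := eqVneq g 0; first by left.
apply/(trop_hypersurfaceP _ g0) => u ug; apply: contrapT => nv.
have pval_lt v : v \in finsupp g -> v != u -> pval (g u) < pval (g v).
  move=> vg vu; rewrite ltNge; apply/negP => vle; apply: nv; exists v; split=> //.
  rewrite /trop_term !big1 ?addr0 ?ler_rat // => j _; by rewrite mxE mulr0.
have gu0 : g u != 0 by rewrite -mem_finsupp.
have [guv guP] := pvalP gu0.
have [N [p [pI pE]]] := bethe_ideal_clear gI.
pose P := ppow R (- pval (g u)) *: p.
have PE a q : mcoeff a P q = g (vec a - const_mx N%:Z) (q + pval (g u)).
  rewrite mcoeffZ pcoef_psingleM mul1r opprK.
  by rewrite -laurent_of_mpoly_coef -pE lcoef_monomM mul1r.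
have P_other a q : vec a - const_mx N%:Z != u -> q <= 0 -> mcoeff a P q = 0.
  move=> au q0; rewrite PE.
  have [ag|ag] := boolP (vec a - const_mx N%:Z \in finsupp g); last first.
    by rewrite fsfun_dflt // pcoef0.
  have [_ H] : g (vec a - const_mx N%:Z) != 0 /\ forall r,
      g (vec a - const_mx N%:Z) r != 0 -> pval (g (vec a - const_mx N%:Z)) <= r.
    by rewrite -mem_finsupp; split=> //; apply pvalP; rewrite -mem_finsupp.
  apply/eqP/negPn/negP => /H; rewrite leNgt => /negP; apply.
  by rewrite (le_lt_trans _ (pval_lt _ ag au)) // gerDr.
have PS : P \is a mpolyOver M (@pint R).
  apply/mpolyOverP => a; apply/pintP => q q0.
  have [au|au] := eqVneq (vec a - const_mx N%:Z) u; last exact: P_other (ltW q0).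
  rewrite PE au; apply/eqP/negPn/negP => /guP; rewrite leNgt => /negP; apply.
  by rewrite gtrDr.
have [z ez z0] := exists_elem_sym_roots dM.
have [q qS PqE] : span_over (@pint R) (bethe_mpoly d) P.
  apply: (span_over_symmetric bethe_correction_deg bethe_correction_int PS).
  rewrite /P -mul_mpolyC; apply: span_overM pI; exact/mpolyOverP.
pose zz j : L := pconst (z j).
have small : psmall (meval zz P).
  rewrite PqE rmorph_sum; apply: psmall_sum => i; rewrite rmorphM; apply: psmallM.
    by apply: meval_int => // j; exact: pconst_int.
  exact (@bethe_mpoly_small z i (ez i.+1 (ltn_ord i))).
have [b ub] : exists b, u + const_mx N%:Z = vec b.
  apply: (@laurent_of_mpoly_supp _ _ p); rewrite -pE lcoef_monomM mul1r.
  by rewrite addrK.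
have bu : vec b - const_mx N%:Z = u by rewrite -ub addrK.
have /eqP := small 0 (lexx 0); apply/negP.
rewrite mevalE pcoef_sum.
have Pb0 : mcoeff b P 0 != 0 by rewrite PE bu add0r.
have bP : b \in msupp P.
  rewrite mcoeff_msupp; apply: contraNneq Pb0 => ->; by rewrite pcoef0.
have zE (a : multinom M) : \prod_i zz i ^+ a i = pconst (\prod_i z i ^+ a i).
  by rewrite rmorph_prod; apply: eq_bigr => i _; rewrite rmorphXn.
under eq_bigr => a _ do rewrite zE pcoefMC.
rewrite (bigD1_seq b) ?msupp_uniq //= [X in _ + X]big1 => [|a ab].
  rewrite addr0 mulf_neq0 //.
  by apply/prodf_neq0 => i _; rewrite expf_neq0.
rewrite P_other ?mul0r // -bu; apply: contraNneq ab.
by move=> /(congr1 (fun u => u + const_mx N%:Z)); rewrite !subrK => /vec_inj->.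
Qed.

End OriginInVariety.
Theorem theorem4p4 (R : realType) (m n : nat) (d : nat -> R[i])
    (Lambda : {poly R[i]})
    (LambdaE : Lambda =
       'X^(m + n) + \sum_(1 <= k < (m + n).+1) d k *: 'X^(m + n - k))
    (d_neq0 : forall k, (1 <= k <= m + n)%N -> d k != 0) :
  let f := @bethe_poly R m n d in
  let T := f @` [set k | (1 <= k <= m + n)%N] in
  let I := ideal_gen T in
  [/\ tropical_basis T I,
      trop_variety I =
        \bigcap_(k in [set k | (1 <= k <= m + n)%N]) trop_hypersurface (f k)
    & trop_variety I = [set 0]].
Proof.
move=> f T I.
have TI g : T g -> I g.
  move=> Tg; exists [:: (1, g)]; last by rewrite big_seq1 mul1r.
  by move=> p; rewrite mem_seq1 => /eqP->.
have capE : \bigcap_(g in T) trop_hypersurface g =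
    \bigcap_(k in [set k | (1 <= k <= m + n)%N]) trop_hypersurface (f k).
  by rewrite /T bigcap_image.
have I_cap : trop_variety I `<=` \bigcap_(g in T) trop_hypersurface g.
  by move=> w wI g /TI; exact: wI.
have cap_0 : \bigcap_(g in T) trop_hypersurface g `<=` [set 0].
  rewrite capE => w wf; have [M0|M0] := posnP (m + n).
    by apply/rowP => j; exfalso; move: (ltn_ord j); rewrite [X in (_ < X)%N]M0.
  apply: (@trop_prevariety_origin R m n d); first by rewrite d_neq0 // M0 leqnn.
  by move=> i; apply: wf => /=.
have zero_I : [set 0] `<=` trop_variety I.
  by move=> _ ->; apply: origin_in_trop_variety => M0; rewrite d_neq0 // M0 leqnn.
have I0 : trop_variety I = [set 0].
  by apply/seteqP; split=> //; apply: subset_trans cap_0.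
have cap0 : \bigcap_(g in T) trop_hypersurface g = [set 0].
  by apply/seteqP; split=> //; apply: subset_trans I_cap.
split; rewrite ?I0 -?capE ?cap0 //; split; rewrite ?I0 ?cap0 //.
apply: finite_image; apply: sub_finite_set (finite_II (m + n).+1) => k /=.
by case/andP.
Qed.
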